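(* Consider $(\mathrm{Gr}^\pm(n),d_{\mathrm{g}})$, i.e. $\mathrm{Gr}(n)$ with the asymmetric geodesic metric $d_{\mathrm{g}}$ and either of the topologies $\tau^-$, $\tau^+$. Then: (i) Minimal geodesics are segments. More precisely, all type I paths are segments; type II paths from $V$ to $W$, with $\dim V=p$ and $\dim W=q$, are segments if and only if $V\perp W$ or $p>q$. (ii) For any $V$ and $W$ there is a segment from $V$ to $W$. (iii) For $U,V,W\in \mathrm{Gr}(n)$, $U\in[V,W]_{d_{\mathrm{g}}}$ if and only if $U$ lies in a segment from $V$ to $W$.
   Context: $\mathbb{F}=\mathbb{R}$ or $\mathbb{C}$, $\mathbb{F}^n$ has its canonical inner product (Hermitian if $\mathbb{F}=\mathbb{C}$), $\mathrm{Gr}(n)$ is the set of all subspaces of $\mathbb{F}^n$, $\mathrm{Gr}_p(n)$ those of dimension $p$; $V_{(p)}$ indicates $\dim V=p$; $\subset$ allows equality. Principal angles of $V_{(p)},W_{(q)}$ with $m=\min\{p,q\}\neq0$: $0\leq\theta_1\leq\cdots\leq\theta_m\leq\frac\pi2$, $\theta_i=\cos^{-1}\sigma_i$, where $\sigma_1\geq\cdots\geq\sigma_m$ are the singular values of the orthogonal projection $V\to W$. For $V_{(p)},W_{(q)}$, the asymmetric geodesic metric is $d_{\mathrm{g}}(V,W)=0$ if $p=0$, $\sqrt{\sum_{i=1}^p\theta_i^2}$ if $0<p\leq q$, and $\frac\pi2\sqrt p$ if $p>q$. Write $d=d_{\mathrm{g}}$. $[V,W]_d=\{U\in \mathrm{Gr}(n):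 d(V,W)=d(V,U)+d(U,W)\}$. Topologies: $\tau^-$ is generated by the balls $B_r^-(V)=\{U:d(U,V)<r\}$ and $\tau^+$ by $B_r^+(V)=\{U:d(V,U)<r\}$. A curve is a continuous map $\gamma:I\to \mathrm{Gr}^\pm(n)$ on an interval $I\subset\mathbb{R}$; if $I=[a,b]$ it is a path from $\gamma(a)$ to $\gamma(b)$. Its length is $L(\gamma)=\sup\sum_{i=1}^{N-1}d(\gamma(t_i),\gamma(t_{i+1}))$ over all $N$ and $t_1<\cdots<t_N$ in $I$. It is null if $L(\gamma)=0$. A path from $V$ to $W$ is a minimal geodesic if its length equals the infimum of the lengths of paths from $V$ to $W$, and a segment if $L(\gamma)=d(V,W)$. $U$ lies in $\gamma$ if $U=\gamma(t)$ for some $t$. One-sided limits: $\lim_{t\to t_0^\pm}\gamma(t)=U$ means that for $t$ close to $t_0$ on that side $\gamma(t)$ lies in a single $\mathrm{Gr}_k(n)$ and converges to $U$ in its usual topology. With $U=\lim_{t\to t_0^-}\gamma(t)$, $X=\gamma(t_0)$, $Y=\lim_{t\to t_0^+}\gamma(t)$, $\gamma$ contracts at $t_0$ from $U$ to $X$ if $U\supsetneq X$, and from $X$ to $Y$ if $X\supsetneq Y$ (disregard $U$ or $Y$ if $t_0$ is the corresponding endpoint of $I$). $\mathcal{P}_W(V)$ is the set of subspaces $W'\subset W$ with $\dim W'=\min\{\dim V,\dim W\}$ and $P_W(V)\subset W'$, where $P_W$ is orthogonal projection. For $\mu,\eta:I\to \mathrm{Gr}(n)$ with $\mu(t)\perp\eta(t)$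 for all $t$, $(\mu\boxplus\eta)(t)$ is the orthogonal direct sum of $\mu(t)$ and $\eta(t)$. A path $\gamma:[a,b]\to \mathrm{Gr}^\pm(n)$ from $V_{(p)}$ to $W$ is: - type I if $\gamma=\mu\boxplus\eta$ where, for some $W'\in\mathcal{P}_W(V)$ and $T=W'^\perp\cap W$, $\mu$ is a minimal geodesic of $\mathrm{Gr}_p(n)$ from $V$ to $W'$ (a path in $\mathrm{Gr}_p(n)$, of minimum length among the paths in $\mathrm{Gr}_p(n)$ from $V$ to $W'$), and $\eta$ is a null path in $\mathrm{Gr}^\pm(n)$ from $0$ to $T$; - type II if $\gamma$ is a null path from $V$ to some $U_{(r)}$ with $\Delta_{r,d}=\Delta_{p,d}$ (where $\Delta_{k,d}=\frac\pi2\sqrt k$ for $d=d_{\mathrm g}$), followed by a contraction from $U$ to some $U'$, followed by a null path from $U'$ to $W$; that is, at some $t_0\in[a,b]$ $\gamma$ contracts from such a $U$ to some $U'$, and $\gamma$ restricted to $[a,t_0)$ and to $(t_0,b]$ (when nonempty) is null. *)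

(* Defs.v *)
From HB Require Import structures.
From mathcomp Require Import all_boot all_order all_algebra complex.
From mathcomp Require Import all_classical all_reals all_analysis.

Set Implicit Arguments.
Unset Strict Implicit.
Unset Printing Implicit Defensive.

Import Order.TTheory GRing.Theory Num.Theory numFieldNormedType.Exports.

Local Open Scope classical_set_scope.
Local Open Scope ring_scope.

Variant scalars := RealScalars | ComplexScalars.

Definition fld (R : realType) (k : scalars) : numFieldType :=
  match k with RealScalars => R | ComplexScalars => R[i] end.

Definition sconj (R : realType) (k : scalars) : fld R k -> fld R k :=
  match k with RealScalars => id | ComplexScalars => @conjc R end.

Definition of_real (R : realType) (k : scalars) : R -> fld R k :=
  match k with RealScalars => id | ComplexScalars => real_complex R end.

Definition Gr (R : realType) (k : scalars) (n : nat) : Type :=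
  {vspace 'rV[fld R k]_n}.

Section InnerProduct.
Variables (R : realType) (k : scalars) (n : nat).
Local Notation F := (fld R k).
Implicit Types (u v w : 'rV[F]_n) (U V W : Gr R k n).

Lemma sconj_is_zmod_morphism : zmod_morphism (@sconj R k).
Proof. by move=> x y; case: k x y => // x y; exact: rmorphB. Qed.

Lemma sconj_is_monoid_morphism : monoid_morphism (@sconj R k).
Proof.
split=> [|x y]; first by case: k => //; exact: rmorph1.
by case: k x y => // x y; exact: rmorphM.
Qed.

HB.instance Definition _ :=
  GRing.isZmodMorphism.Build F F (@sconj R k) sconj_is_zmod_morphism.
HB.instance Definition _ :=
  GRing.isMonoidMorphism.Build F F (@sconj R k) sconj_is_monoid_morphism.

Lemma sconjK : involutive (@sconj R k).
Proof. by case: k => // x; exact: conjcK. Qed.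

Lemma mul_sconj_ge0 (x : F) : 0 <= x * sconj x.
Proof.
case: k x => /= x; first by rewrite -expr2 sqr_ge0.
by rewrite -sqr_normc exprn_ge0.
Qed.

Lemma mul_sconj_eq0 (x : F) : x * sconj x = 0 -> x = 0.
Proof. by move/eqP; rewrite mulf_eq0 fmorph_eq0 orbb => /eqP. Qed.

Definition dot u v : F := \sum_(i < n) u 0 i * sconj (v 0 i).

Lemma dot_is_bilinear :
  bilinear_for (GRing.Scale.Law.clone _ _ *%R _)
    (GRing.Scale.Law.clone _ _ (@sconj R k \; *%R) _) dot.
Proof.
split=> [w|w] a x y /=; rewrite /dot mulr_sumr -big_split /=;
  apply: eq_bigr => i _; rewrite !mxE.
  by rewrite mulrDl mulrA.
by rewrite rmorphD rmorphM mulrDr mulrCA.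
Qed.

HB.instance Definition _ := bilinear_isBilinear.Build F
  'rV[F]_n 'rV[F]_n F _ _ dot dot_is_bilinear.

Lemma dot_is_hermitian u v : dot u v = (-1) ^+ false * sconj (dot v u).
Proof.
rewrite mul1r rmorph_sum; apply: eq_bigr => i _.
by rewrite rmorphM /= sconjK mulrC.
Qed.

HB.instance Definition _ :=
  isHermitianSesquilinear.Build F 'rV[F]_n false (@sconj R k) dot
    dot_is_hermitian.

Lemma dot_ge0 u : 0 <= dot u u.
Proof. by apply: sumr_ge0 => i _; exact: mul_sconj_ge0. Qed.

Lemma dot_eq0 u : dot u u = 0 -> u = 0.
Proof.
move/eqP; rewrite psumr_eq0; last by move=> i _; exact: mul_sconj_ge0.
move/allP => h; apply/rowP => i; rewrite mxE; apply: mul_sconj_eq0.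
by have := h i (mem_index_enum i) => /eqP.
Qed.

Lemma dot_gt0 u : u != 0 -> 0 < dot u u.
Proof.
move=> u0; rewrite lt_neqAle dot_ge0 eq_sym andbT.
by apply: contra u0 => /eqP/dot_eq0 ->.
Qed.

HB.instance Definition _ := isDotProduct.Build F 'rV[F]_n dot dot_gt0.

Definition orthc W : Gr R k n := orthov dot W.

Definition perp V W : bool := (V <= orthc W)%VS.

Definition orthoproj W : 'End('rV[F]_n) := daddv_pi W (orthc W).

Definition orthonormal_basis V (e : seq 'rV[F]_n) : bool :=
  basis_of V e && orthonormal dot e.

Lemma capv_orthc W : (W :&: orthc W = 0)%VS.
Proof.
apply/eqP; rewrite -subv0; apply/subvP => u; rewrite memv_cap => /andP[uW].
by move=> /mem_orthovP /(_ _ uW) /dot_eq0 ->; rewrite mem0v.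
Qed.

Lemma addv_orthc W : (W + orthc W = fullv)%VS.
Proof.
apply/eqP; rewrite eqEdim subvf /= dimv_disjoint_sum ?capv_orthc //.
pose f : 'rV[F]_n -> 'rV[F]_(\dim W) :=
  mulmxr (\matrix_(i < n, j < \dim W) sconj ((vbasis W)`_j 0 i)).
have kerf : (lker (linfun f) <= orthc W)%VS.
  apply/subvP => u; rewrite memv_ker lfunE => /eqP/rowP fu.
  apply/mem_orthovP => w wW.
  rewrite (coord_vbasis wW) linear_sumr big1 // => j _.
  rewrite linearZr_LR /= [X in _ * X](_ : _ = 0) ?mulr0 //.
  have := fu j; rewrite !mxE => hj.
  by rewrite -[RHS]hj; apply: eq_bigr => i _; rewrite mxE.
have := limg_ker_dim (linfun f) fullv.
rewrite (capv_idPr (subvf _)) => <-; rewrite addnC leq_add ?dimvS //.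
by apply: leq_trans (dimvS (subvf _)) _; rewrite dimvf /dim /= mul1n.
Qed.

Lemma orthoproj_mem W u : orthoproj W u \in W.
Proof. exact: memv_pi. Qed.

Lemma orthoproj_orthc W u : u - orthoproj W u \in orthc W.
Proof.
have uW : u \in (W + orthc W)%VS by rewrite addv_orthc memvf.
rewrite -[X in X - _](daddv_pi_add (capv_orthc W) uW) addrC addKr.
exact: memv_pi.
Qed.

End InnerProduct.

Section AsymmetricMetric.
Variables (R : realType) (k : scalars) (n : nat).
Implicit Types U V W : Gr R k n.

(* A singular value decomposition of f : V -> W.  Entries of s and of the
   bases beyond their size are 0, so f e_i = 0 for \dim W <= i < \dim V. *)
Definition singular_values V W (f : 'End('rV[fld R k]_n)) (s : seq R) : Prop :=
  [/\ size s = minn (\dim V) (\dim W),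
      sorted >=%R s,
      forall i, 0 <= s`_i
    & exists e g : seq 'rV[fld R k]_n,
        [/\ orthonormal_basis V e, orthonormal_basis W g
          & forall i, (i < \dim V)%N -> f e`_i = of_real k s`_i *: g`_i]].

Definition principal_angles V W : seq R :=
  [seq acos x | x <- xget [::] [set s | singular_values V W (orthoproj W) s]].

Definition Delta (p : nat) : R := pi / 2 * Num.sqrt p%:R.

Definition dg V W : R :=
  if \dim V == 0%N then 0
  else if (\dim V <= \dim W)%N
       then Num.sqrt (\sum_(i < \dim V) (principal_angles V W)`_i ^+ 2)
       else Delta (\dim V).

Definition dbetween V W : set (Gr R k n) :=
  [set U | dg V W = dg V U + dg U W].

Definition proj_subspaces V W : set (Gr R k n) :=
  [set W' : Gr R k n | [/\ (W' <= W)%VS,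
             \dim W' = minn (\dim V) (\dim W)
           & (orthoproj W @: V <= W')%VS]].

End AsymmetricMetric.

Variant side := Minus | Plus.

(* An alias of Gr n, so that the topologies generated by the balls on each side
   can both be canonical. *)
Definition Gr_top (R : realType) (k : scalars) (n : nat) (s : side) : Type :=
  Gr R k n.

Definition gr_ball (R : realType) (k : scalars) (n : nat) (s : side)
    (V : Gr R k n) (r : R) : set (Gr R k n) :=
  match s with
  | Minus => [set U | dg U V < r]
  | Plus => [set U | dg V U < r]
  end.

HB.instance Definition _ (R : realType) k n s :=
  Choice.copy (Gr_top R k n s) {vspace 'rV[fld R k]_n}.
HB.instance Definition _ (R : realType) k n s :=
  isPointed.Build (Gr_top R k n s) (0%VS : {vspace 'rV[fld R k]_n}).
HB.instance Definition _ (R : realType) k n s :=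
  @isSubBaseTopological.Build (Gr_top R k n s)
    (Gr_top R k n s * R)%type [set Vr | 0 < Vr.2]
    (fun Vr => gr_ball s (Vr.1 : Gr R k n) Vr.2).

(* A curve on I is represented by a total function R -> Gr n, of which only
   the values on I matter. *)
Section Curves.
Variables (R : realType) (k : scalars) (n : nat) (s : side).
Implicit Types (I : set R) (U V W : Gr R k n) (A : set (Gr R k n)).
Implicit Types (gamma mu eta : R -> Gr R k n) (a b : R).

Definition curve I gamma : Prop :=
  {within I, continuous (gamma : R -> Gr_top R k n s)}.

Definition polygonal_length gamma (t : seq R) : R :=
  \sum_(i < (size t).-1) dg (gamma t`_i) (gamma t`_i.+1).

Definition curve_length I gamma : \bar R :=
  ereal_sup [set (polygonal_length gamma t)%:E |
    t in [set t : seq R | sorted <%R t /\ {in t, forall x, I x}]].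

Definition null_curve I gamma : Prop := curve_length I gamma = 0%E.

Definition path_in A V W a b gamma : Prop :=
  [/\ a <= b, curve `[a, b] gamma, gamma a = V, gamma b = W
    & forall t, t \in `[a, b] -> A (gamma t)].

Definition is_path V W a b gamma : Prop := path_in setT V W a b gamma.

Definition minimal_geodesic_in A V W a b gamma : Prop :=
  path_in A V W a b gamma /\
  curve_length `[a, b] gamma =
    ereal_inf [set l | exists a' b' gamma',
      path_in A V W a' b' gamma' /\ l = curve_length `[a', b'] gamma'].

Definition minimal_geodesic V W a b gamma : Prop :=
  minimal_geodesic_in setT V W a b gamma.

Definition segment V W a b gamma : Prop :=
  is_path V W a b gamma /\ curve_length `[a, b] gamma = (dg V W)%:E.

(* The usual topology of each Gr_p(n) is the one induced by identifying a
   subspace with its orthogonal projector. *)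
Definition gr_cvg (T : set_system R) gamma U : Prop :=
  (\forall t \near T, \dim (gamma t) = \dim U) /\
  lin1_mx (orthoproj (gamma t)) @[t --> T] --> lin1_mx (orthoproj U).

Definition contracts a b gamma (t0 : R) U U' : Prop :=
  (U' != U /\ (U' <= U)%VS) /\
  ((a < t0 /\ gr_cvg t0^'- gamma U /\ U' = gamma t0) \/
   (t0 < b /\ U = gamma t0 /\ gr_cvg t0^'+ gamma U')).

Definition type_I V W a b gamma : Prop :=
  is_path V W a b gamma /\
  exists (W' : Gr R k n) mu eta,
    [/\ proj_subspaces V W W',
        minimal_geodesic_in [set U : Gr R k n | \dim U = \dim V] V W' a b mu,
        is_path 0%VS (orthc W' :&: W)%VS a b eta,
        null_curve `[a, b] eta
      & forall t, t \in `[a, b] ->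
          perp (mu t) (eta t) /\ gamma t = (mu t + eta t)%VS].

Definition type_II V W a b gamma : Prop :=
  is_path V W a b gamma /\
  exists t0 (U U' : Gr R k n),
    [/\ t0 \in `[a, b],
        Delta R (\dim U) = Delta R (\dim V),
        contracts a b gamma t0 U U',
        null_curve `[a, t0[ gamma
      & null_curve `]t0, b] gamma].

End Curves.

(* Main.v *)
Require Import Defs.
From HB Require Import structures.
From mathcomp Require Import all_boot all_order all_algebra complex.
From mathcomp Require Import all_classical all_reals all_analysis.
From mathcomp Require Import finmap.
From mathcomp Require Import zify ring lra.

(** Everything rests on the triangle inequality for [dg] ([dg_triangle]); the
    rest is an analysis of lengths and of the two topologies.

    The principal angles between [V] and [W] are read off orthonormal bases of
    [V] and [W] with diagonal Gram matrix ([principal]), which exist by the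
    spectral theorem ([principal_exists]) and whose diagonal is unique by the
    Courant-Fischer argument ([principal_compare]).  The latter also shows that
    enlarging [W] decreases [dg V W].

    Triangle inequality.  If [\dim V], [\dim U] and [\dim W] are not in
    nondecreasing order, one of the two distances on the right is already at
    least the maximum [Delta R (\dim V)] of the left.  Otherwise let [U'] have
    the dimension of [U], and let
    [th i] and [th' i] be the angles of [V] with [U] and with [U'], completed by
    right angles.  Splitting the principal vectors of [U] and [U'] into their
    components along [V] and its complement, of lengths cosine and sine, the von
    Neumann trace argument gives
      [\sum_i cos (angle_i (U, U')) <= \sum_i cos (th i - th' i)]
    ([trace_inequality]).  Cosines being chords, this bounds the chords of the
    differences [th i - th' i] by those of the angles between [U] and [U'], so
    [dg V U' <= dg V U + dg U U'] up to a correction that is of second order in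
    [dg U U'] ([dg_local]).  Subdividing the constant speed geodesic from [U] to
    a subspace of [W] ([geodesic_exists]) into [N] pieces and letting [N] grow
    removes the correction.

    Segments.  By the triangle inequality, the balls centred at a point are a
    basis of its neighbourhoods, and a path is a segment if and only if its
    distances are bounded by the increments of a function that increases by at
    most [dg V W] in all ([segment_of_potential], [potential_of_length]).
    Geodesics and jumps between comparable subspaces are segments, and
    segments can be concatenated at a point between their ends; this yields (ii)
    and (iii), and (i) for minimal geodesics.  Along a type I path the null part
    is an orthogonal summand that does not increase distances
    ([dg_add_common]).  In a type II path continuity leaves exactly one
    contraction, out of a subspace of dimension [\dim V], so its length is
    [Delta R (\dim V)] ([type_II_length]), and this is [dg V W] exactly when
    [V] is orthogonal to [W] or has larger dimension ([dg_eq_DeltaP]). *)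


Set Implicit Arguments.
Unset Strict Implicit.
Unset Printing Implicit Defensive.

Import Order.TTheory GRing.Theory Num.Theory numFieldNormedType.Exports.

Local Open Scope classical_set_scope.
Local Open Scope ring_scope.

(** * Real parts and squared moduli of scalars *)

Definition rpart (R : realType) (k : scalars) : fld R k -> R :=
  match k with RealScalars => id | ComplexScalars => @complex.Re R end.

Definition sqn (R : realType) (k : scalars) (x : fld R k) : R :=
  rpart (x * sconj x).

Section Scalars.
Variables (R : realType) (k : scalars).
Local Notation F := (fld R k).
Implicit Types (x y : F) (a : R).

Lemma rpart_is_zmod_morphism : zmod_morphism (@rpart R k).
Proof. by case: k => // [[a b] [c d]]. Qed.

HB.instance Definition _ :=
  GRing.isZmodMorphism.Build F R (@rpart R k) rpart_is_zmod_morphism.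

Lemma of_real_is_zmod_morphism : zmod_morphism (@of_real R k).
Proof. by case: k => // a b /=; rewrite rmorphB. Qed.

Lemma of_real_is_monoid_morphism : monoid_morphism (@of_real R k).
Proof. by case: k => //=; split=> [|a b]; rewrite ?rmorph1 ?rmorphM. Qed.

HB.instance Definition _ :=
  GRing.isZmodMorphism.Build R F (@of_real R k) of_real_is_zmod_morphism.
HB.instance Definition _ :=
  GRing.isMonoidMorphism.Build R F (@of_real R k) of_real_is_monoid_morphism.

Lemma of_realK : cancel (@of_real R k) (@rpart R k).
Proof. by case: k. Qed.

Lemma of_real_inj : injective (@of_real R k).
Proof. exact: can_inj of_realK. Qed.

Lemma rpart_realM a x : rpart (of_real k a * x) = a * rpart x.
Proof. by case: k x => //= [[c d]]; rewrite /= mul0r subr0. Qed.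

Lemma rpart_conj x : rpart (sconj x) = rpart x.
Proof. by case: k x => //= [[c d]]. Qed.

Lemma sconj_real a : sconj (of_real k a) = of_real k a.
Proof. by case: k => //=; rewrite oppr0. Qed.

Lemma sqnE x : of_real k (sqn x) = x * sconj x.
Proof.
rewrite /sqn; case: k x => //= [[c d]]; apply/eqP; rewrite eq_complex /=.
by rewrite eqxx mulrN addrC [d * c]mulrC subrr eqxx.
Qed.

Lemma sqn_ge0 x : 0 <= sqn x.
Proof.
rewrite /sqn; case: k x => [x|[c d]] /=; first by rewrite -expr2 sqr_ge0.
by rewrite mulrN opprK addr_ge0 // -expr2 sqr_ge0.
Qed.

Lemma sqn_conj x : sqn (sconj x) = sqn x.
Proof. by apply: of_real_inj; rewrite !sqnE sconjK mulrC. Qed.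

Lemma sqn_real a : sqn (of_real k a) = a ^+ 2.
Proof.
by apply: of_real_inj; rewrite !sqnE sconj_real rmorphXn /= expr2.
Qed.

Lemma sqn0 : sqn (0 : F) = 0.
Proof. by rewrite /sqn mul0r raddf0. Qed.

(** The squared modulus of [x - sconj y] is nonnegative. *)
Lemma rpartM_le x y : rpart (x * y) <= (sqn x + sqn y) / 2.
Proof.
have := sqn_ge0 (x - sconj y).
rewrite /sqn rmorphB /= sconjK mulrBr !mulrBl !raddfB /= -/(sqn x).
rewrite [sconj y * sconj x]mulrC -rmorphM rpart_conj [sconj y * y]mulrC -/(sqn y).
lra.
Qed.

End Scalars.

(** * Orthonormal frames and orthogonal projections *)

Section Frames.
Variables (R : realType) (k : scalars) (n : nat).
Local Notation F := (fld R k).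
Local Notation vec := 'rV[F]_n.
Local Notation dot := (@dot R k n).
Implicit Types (u v w x y : vec) (U V W : Gr R k n) (e f g : nat -> vec).

Definition nrm2 u : R := rpart (dot u u).

Lemma dotC u v : dot u v = sconj (dot v u).
Proof. by rewrite (dot_is_hermitian u v) expr0 mul1r. Qed.

Lemma dotDl u v w : dot (u + v) w = dot u w + dot v w.
Proof. exact: linearDl. Qed.
Lemma dotDr u v w : dot w (u + v) = dot w u + dot w v.
Proof. exact: linearDr. Qed.
Lemma dotNl u v : dot (- u) v = - dot u v.
Proof. exact: linearNl. Qed.
Lemma dotNr u v : dot u (- v) = - dot u v.
Proof. exact: linearNr. Qed.
Lemma dotBl u v w : dot (u - v) w = dot u w - dot v w.
Proof. by rewrite dotDl dotNl. Qed.
Lemma dotBr u v w : dot w (u - v) = dot w u - dot w v.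
Proof. by rewrite dotDr dotNr. Qed.
Lemma dotZl a u v : dot (a *: u) v = a * dot u v.
Proof. exact: linearZl_LR. Qed.
Lemma dotZr a u v : dot u (a *: v) = sconj a * dot u v.
Proof. exact: linearZr_LR. Qed.
Lemma dot0l v : dot 0 v = 0.
Proof. exact: linear0l. Qed.
Lemma dot0r v : dot v 0 = 0.
Proof. exact: linear0r. Qed.
Lemma dot_suml (I : Type) (r : seq I) (P : pred I) (f : I -> vec) v :
  dot (\sum_(i <- r | P i) f i) v = \sum_(i <- r | P i) dot (f i) v.
Proof. by apply: (big_morph (dot^~ v)) => [x y|]; rewrite ?dotDl ?dot0l. Qed.
Lemma dot_sumr (I : Type) (r : seq I) (P : pred I) (f : I -> vec) v :
  dot v (\sum_(i <- r | P i) f i) = \sum_(i <- r | P i) dot v (f i).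
Proof. by apply: (big_morph (dot v)) => [x y|]; rewrite ?dotDr ?dot0r. Qed.

Lemma dot_eq0C u v : dot u v = 0 -> dot v u = 0.
Proof. by rewrite dotC => h; rewrite -[dot v u](sconjK) h rmorph0. Qed.

Lemma nrm2E u : of_real k (nrm2 u) = dot u u.
Proof.
rewrite /nrm2 /Defs.dot raddf_sum /= rmorph_sum /=; apply: eq_bigr => i _.
exact: sqnE.
Qed.

Lemma nrm2_ge0 u : 0 <= nrm2 u.
Proof.
rewrite /nrm2 /Defs.dot raddf_sum /=; apply: sumr_ge0 => i _; exact: sqn_ge0.
Qed.

Lemma nrm2_eq0 u : nrm2 u = 0 -> u = 0.
Proof. by move=> h; apply: dot_eq0; rewrite -nrm2E h rmorph0. Qed.

Lemma nrm2_gt0 u : u != 0 -> 0 < nrm2 u.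
Proof.
by move=> u0; rewrite lt_def nrm2_ge0 andbT; apply: contra_neq u0; exact: nrm2_eq0.
Qed.

Lemma nrm2Z a u : nrm2 (a *: u) = sqn a * nrm2 u.
Proof.
by apply: (@of_real_inj R k); rewrite nrm2E rmorphM /= sqnE nrm2E dotZl dotZr mulrA.
Qed.

(** An orthonormal basis of [V], indexed by [nat] and extended by zero from
    [\dim V] on: vectors can then be named, and families of different sizes
    compared, without bounds on the indices. *)
Definition frame V e : Prop :=
  (forall i, e i \in V) /\
  (forall i j, dot (e i) (e j) = ((i == j) && (i < \dim V)%N)%:R).

Lemma frame_mem V e : frame V e -> forall i, e i \in V.
Proof. by case. Qed.

Lemma frame_dot V e : frame V e ->
  forall i j, dot (e i) (e j) = ((i == j) && (i < \dim V)%N)%:R.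
Proof. by case. Qed.

Lemma frame_default V e : frame V e -> forall i, (\dim V <= i)%N -> e i = 0.
Proof.
by move=> [_ h] i le; apply: dot_eq0; rewrite h eqxx ltnNge le.
Qed.

Lemma orthonormal_nthP (s : seq vec) :
  reflect (forall i j, dot s`_i s`_j = ((i == j) && (i < size s)%N)%:R)
          (orthonormal dot s).
Proof.
have pairE (t : seq vec) : pair_ortho_rec dot t =
    pairwise (fun u v => dot u v == 0) t.
  elim: t => //= v t ->; congr (_ && _).
  by rewrite /ortho_rec /= andbT.
rewrite /orthonormal pairE.
apply: (iffP andP) => [[/all_nthP h1 /(pairwiseP 0) h2] i j|h].
  have [ilt|ige] := ltnP i (size s); last first.
    by rewrite nth_default // dot0l andbF.
  have [jlt|jge] := ltnP j (size s); last first.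
    rewrite [s`_j]nth_default // dot0r; case: eqP => // ij.
    by rewrite -ij leqNgt ilt in jge.
  rewrite andbT; case: ltngtP => [ij|ij|->]; last exact/eqP/h1.
    exact/eqP/h2.
  by apply/dot_eq0C/eqP/h2.
split; first by apply/(all_nthP 0) => i ilt /=; rewrite h eqxx ilt.
apply/(pairwiseP 0) => i j _ _ ij; rewrite h.
by rewrite (ltn_eqF ij).
Qed.

Lemma free_orthonormal (s : seq vec) : orthonormal dot s -> free s.
Proof.
move=> /orthonormal_nthP h; rewrite -[s]/(tval (in_tuple s)).
apply/freeP => c h0 i; have := congr1 (dot^~ s`_i) h0.
rewrite dot0l dot_suml (bigD1 i) //= big1 => [|j ji].
  by rewrite dotZl h eqxx ltn_ord mulr1 addr0.
by rewrite dotZl h val_eqE (negPf ji) mulr0.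
Qed.

Lemma orthonormal_basis_frame V (s : seq vec) :
  orthonormal_basis V s -> size s = \dim V /\ frame V (nth 0 s).
Proof.
move=> /andP[sV so]; have sz : size s = \dim V.
  by move: sV => /andP[/eqP <- /eqP].
split=> //; split=> [i|i j].
  have [ilt|ige] := ltnP i (size s); last by rewrite nth_default // mem0v.
  by apply: (basis_mem sV); rewrite mem_nth.
by rewrite (orthonormal_nthP _ so) sz.
Qed.

Lemma frame_orthonormal_basis V e :
  frame V e -> orthonormal_basis V (mkseq e (\dim V)).
Proof.
move=> fV; have nE i : (mkseq e (\dim V))`_i = e i.
  have [ilt|ige] := ltnP i (\dim V); first by rewrite nth_mkseq.
  by rewrite nth_default ?size_mkseq // (frame_default fV).
have on : orthonormal dot (mkseq e (\dim V)).
  by apply/orthonormal_nthP => i j; rewrite !nE size_mkseq (frame_dot fV).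
rewrite /orthonormal_basis on andbT basisEfree free_orthonormal //=.
rewrite size_mkseq leqnn andbT; apply/span_subvP => x /mapP[i _ ->].
exact: frame_mem.
Qed.

Definition spanned (m : nat) e : Gr R k n := <<mkseq e m>>%VS.

Lemma frame_spanned m e :
  (forall i j, dot (e i) (e j) = ((i == j) && (i < m)%N)%:R) ->
  \dim (spanned m e) = m /\ frame (spanned m e) e.
Proof.
move=> h; have e0 i : (m <= i)%N -> e i = 0.
  by move=> le; apply: dot_eq0; rewrite h ltnNge le andbF.
have d : \dim (spanned m e) = m.
  rewrite -[RHS](size_mkseq e m); apply/eqP/free_orthonormal/orthonormal_nthP.
  move=> i j; rewrite size_mkseq -h.
  have nE l : (mkseq e m)`_l = e l.
    have [ilt|ige] := ltnP l m; first by rewrite nth_mkseq.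
    by rewrite nth_default ?size_mkseq // e0.
  by rewrite !nE.
split=> //; split=> [i|i j]; last by rewrite h d.
have [ilt|ige] := ltnP i m; last by rewrite e0 // mem0v.
by apply/memv_span/mapP; exists i => //; rewrite mem_iota.
Qed.

Lemma frame_expand V e x :
  frame V e -> x \in V -> x = \sum_(i < \dim V) dot x (e i) *: e i.
Proof.
move=> fV xV; have /andP[bV _] := frame_orthonormal_basis fV.
have sz : size (mkseq e (\dim V)) == \dim V by rewrite size_mkseq.
have := @coord_basis _ _ V _ (Tuple sz) x bV xV.
set c := coord _ => h.
rewrite {1}h; apply: eq_bigr => i _; rewrite /= nth_mkseq //; congr (_ *: _).
rewrite {2}h dot_suml (bigD1 i) //= big1 => [|j ji].
  by rewrite dotZl nth_mkseq // (frame_dot fV) eqxx ltn_ord mulr1 addr0.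
by rewrite dotZl nth_mkseq // (frame_dot fV) val_eqE (negPf ji) mulr0.
Qed.

Lemma parseval V e x y : frame V e -> x \in V ->
  dot x y = \sum_(i < \dim V) dot x (e i) * sconj (dot y (e i)).
Proof.
move=> fV xV; rewrite {1}(frame_expand fV xV) dot_suml.
by apply: eq_bigr => i _; rewrite dotZl [dot (e i) y]dotC.
Qed.

Lemma nrm2_frame V e x : frame V e -> x \in V ->
  nrm2 x = \sum_(i < \dim V) sqn (dot x (e i)).
Proof.
by move=> fV xV; rewrite /nrm2 (parseval x fV xV) raddf_sum.
Qed.

(** Bessel's inequality.  Norms are only bounded by 1, not equal to it, because
    the families used here vanish at some indices. *)
Lemma bessel m e x : (forall i j, i != j -> dot (e i) (e j) = 0) ->
  (forall i, nrm2 (e i) <= 1) ->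
  \sum_(i < m) sqn (dot x (e i)) <= nrm2 x.
Proof.
move=> eo e1; pose c i := dot x (e i); pose y := \sum_(i < m) c i *: e i.
have dxy : dot x y = of_real k (\sum_(i < m) sqn (c i)).
  rewrite dot_sumr rmorph_sum /=; apply: eq_bigr => i _.
  by rewrite dotZr sqnE mulrC.
have dyy : dot y y = of_real k (\sum_(i < m) sqn (c i) * nrm2 (e i)).
  rewrite {1}/y dot_suml rmorph_sum /=; apply: eq_bigr => i _.
  rewrite dot_sumr (bigD1 i) //= big1 => [|j ji].
    by rewrite addr0 dotZl dotZr -nrm2E rmorphM /= sqnE; ring.
  by rewrite dotZl dotZr eo 1?eq_sym // !mulr0.
have := nrm2_ge0 (x - y).
rewrite /nrm2 dotBl !dotBr [dot y x]dotC dxy dyy sconj_real !raddfB /= !of_realK.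
have : \sum_(i < m) sqn (c i) * nrm2 (e i) <= \sum_(i < m) sqn (c i).
  by apply: ler_sum => i _; rewrite ler_piMr // sqn_ge0.
by rewrite -/(nrm2 x) -/(c _); lra.
Qed.

Lemma frame_nrm2_le1 V e : frame V e -> forall i, nrm2 (e i) <= 1.
Proof.
move=> fV i; rewrite /nrm2 (frame_dot fV) eqxx /=.
by case: ltnP => _; rewrite -?(rmorph1 (@of_real R k)) ?of_realK ?raddf0 ?ler01.
Qed.

Lemma frame_ortho V e : frame V e -> forall i j, i != j -> dot (e i) (e j) = 0.
Proof. by move=> fV i j ij; rewrite (frame_dot fV) (negPf ij). Qed.

Lemma frame_bessel V e m x : frame V e ->
  \sum_(i < m) sqn (dot x (e i)) <= nrm2 x.
Proof. by move=> fV; apply: bessel; [exact: frame_ortho fV|exact: frame_nrm2_le1 fV]. Qed.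

Lemma orthcP W u : (u \in orthc W) <-> (forall w, w \in W -> dot u w = 0).
Proof. by split=> [/mem_orthovP h w /h|h]; last exact/mem_orthovP. Qed.

Lemma proj_dot W u w : w \in W -> dot (orthoproj W u) w = dot u w.
Proof.
move=> wW; have /orthcP/(_ _ wW)/eqP := orthoproj_orthc W u.
by rewrite dotBl subr_eq0 => /eqP.
Qed.

Lemma proj_unique W u w : w \in W ->
  (forall x, x \in W -> dot (u - w) x = 0) -> orthoproj W u = w.
Proof.
move=> wW h; apply/eqP; rewrite -subr_eq0; apply/eqP/dot_eq0.
have xW : orthoproj W u - w \in W by rewrite rpredB // orthoproj_mem.
rewrite {1}dotBl proj_dot // -dotBl; exact: h.
Qed.

Lemma proj_id W u : u \in W -> orthoproj W u = u.
Proof. by move=> uW; apply: proj_unique => // x _; rewrite subrr dot0l. Qed.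

Lemma proj_frame W g u : frame W g ->
  orthoproj W u = \sum_(i < \dim W) dot u (g i) *: g i.
Proof.
move=> fW; rewrite (frame_expand fW (orthoproj_mem W u)).
by apply: eq_bigr => i _; rewrite proj_dot // frame_mem.
Qed.

Lemma nrm2_proj W g u : frame W g ->
  nrm2 (orthoproj W u) = \sum_(i < \dim W) sqn (dot u (g i)).
Proof.
move=> fW; rewrite (nrm2_frame fW (orthoproj_mem W u)).
by apply: eq_bigr => i _; rewrite proj_dot // (frame_mem fW).
Qed.

Lemma orthcK_dim W : (\dim W + \dim (orthc W) = n)%N.
Proof.
have := dimv_disjoint_sum (capv_orthc W).
by rewrite addv_orthc => <-; rewrite dimvf /dim /= mul1n.
Qed.

Lemma perpP V W : perp V W <-> (forall v w, v \in V -> w \in W -> dot v w = 0).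
Proof.
split=> [/subvP h v w vV wW|h]; first by have /orthcP := h _ vV; apply.
by apply/subvP => v vV; apply/orthcP => w; exact: h.
Qed.

(** The orthogonal complement of [ws] has codimension at most [size ws], so it
    meets [V]. *)
Lemma exists_orthogonal V (ws : seq vec) : (size ws < \dim V)%N ->
  exists v, [/\ v \in V, v != 0 & forall w, w \in ws -> dot v w = 0].
Proof.
move=> lt; pose X : Gr R k n := <<ws>>%VS.
have dX : (\dim X <= size ws)%N by exact: dim_span.
have c : (V :&: orthc X != 0)%VS.
  rewrite -dimv_eq0 -lt0n.
  have := dimv_sum_cap V (orthc X); have := orthcK_dim X.
  have := dimvS (subvf (V + orthc X)%VS).
  rewrite dimvf /dim /= mul1n; lia.
have := memv_pick (V :&: orthc X)%VS; rewrite memv_cap => /andP[vV vX].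
exists (vpick (V :&: orthc X)%VS); split=> //; first by rewrite vpick0.
by move=> w ws_w; have /orthcP := vX; apply; exact: memv_span.
Qed.

End Frames.

(** * Principal bases of a pair of subspaces *)

Section Spectral.
Variables (R : realType).

Definition selfadjoint_mx k p (A : 'M[fld R k]_p) : Prop :=
  forall i j, A i j = sconj (A j i).

Lemma selfadjoint_dot k p (A : 'M[fld R k]_p) (u v : 'rV_p) :
  selfadjoint_mx A -> dot (u *m A) v = dot u (v *m A).
Proof.
move=> hA; rewrite /dot.
under eq_bigr do rewrite mxE mulr_suml.
rewrite exchange_big /=; apply: eq_bigr => i _.
rewrite mxE rmorph_sum mulr_sumr /=; apply: eq_bigr => j _.
by rewrite (hA i j) rmorphM /=; ring.
Qed.

Lemma complex_eigen p (A : 'M[R[i]]_p) : (0 < p)%N ->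
  exists a, eigenvalue A a.
Proof.
move=> p0; have /closed_rootP[a ra] : size (char_poly A) != 1.
  by rewrite size_char_poly; case: p A p0.
by exists a; rewrite eigenvalue_root_char.
Qed.

(** In the real case the eigenvalue is found over the complex numbers, where it
    is real because the matrix is self-adjoint. *)
Lemma selfadjoint_eigen k p (A : 'M[fld R k]_p) : (0 < p)%N ->
  selfadjoint_mx A -> exists a, eigenvalue A a.
Proof.
case: k A => A p0 hA; last exact: complex_eigen.
pose B : 'M[fld R ComplexScalars]_p := map_mx (real_complex R) A.
have hB : selfadjoint_mx B by move=> i j; rewrite !mxE (hA i j) /= oppr0.
have [z ev] := complex_eigen B p0.
have [v vB v0] : exists2 v : 'rV[fld R ComplexScalars]_p, v *m B = z *: v & v != 0.
  exact/eigenvalueP.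
have : z * dot v v = @sconj R ComplexScalars z * dot v v.
  by rewrite -(@dotZl R ComplexScalars p z v v) -(@dotZr R ComplexScalars p z v v) -vB selfadjoint_dot.
move/mulIf => zE.
have {}zE : z = @sconj R ComplexScalars z by apply: zE; apply: contra_neq v0; exact: (@dot_eq0 R ComplexScalars p v).
have {zE} : z = real_complex R (complex.Re z).
  case: z zE {ev vB} => c d /= [/eqP]; rewrite -addr_eq0 -mulr2n mulrn_eq0 /=.
  by move=> /eqP ->.
move=> zE; exists (complex.Re z); rewrite eigenvalue_root_char.
move: ev; rewrite eigenvalue_root_char {1}zE /B.
by rewrite /= -map_char_poly fmorph_root.
Qed.

End Spectral.

Section Principal.
Variables (R : realType) (k : scalars) (n : nat).
Local Notation F := (fld R k).
Local Notation vec := 'rV[F]_n.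
Local Notation dot := (@dot R k n).
Implicit Types (u v w x y : vec) (U V W : Gr R k n) (e f g : nat -> vec).

Definition normalize u : vec := of_real k (Num.sqrt (nrm2 u))^-1 *: u.

Lemma nrm2_normalize u : u != 0 -> nrm2 (normalize u) = 1.
Proof.
move=> /nrm2_gt0 u0; rewrite nrm2Z sqn_real exprVn sqr_sqrtr ?ltW //.
by rewrite mulVf // gt_eqF.
Qed.

Lemma dot_nrm1 u : nrm2 u = 1 -> dot u u = 1.
Proof. by move=> h; rewrite -nrm2E h rmorph1. Qed.

Lemma frame_scons V e v : v \in V -> nrm2 v = 1 ->
  frame (V :&: orthc <[v]>)%VS e ->
  frame V (fun i => if i is j.+1 then e j else v).
Proof.
move=> vV v1 fe; have d : \dim V = (\dim (V :&: orthc <[v]>)%VS).+1.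
  have vNo : v \notin orthc V.
    apply/negP => /orthcP/(_ _ vV); rewrite dot_nrm1 // => /eqP.
    by rewrite oner_eq0.
  rewrite /orthc -(eq_dim_orthov1 vNo) prednK // lt0n dimv_eq0.
  apply/negP => /eqP V0; move: vV; rewrite V0 memv0 => /eqP v0.
  by move: v1; rewrite v0 /nrm2 dot0l raddf0 => /esym/eqP; rewrite oner_eq0.
have eo j : dot (e j) v = 0.
  have := frame_mem fe j; rewrite memv_cap => /andP[_ /orthcP]; apply.
  exact: memv_line.
split=> [[|i]|[|i] [|j]] //=.
- by have := frame_mem fe i; rewrite memv_cap => /andP[].
- by rewrite dot_nrm1 // d.
- by rewrite (dot_eq0C (eo j)).
- by rewrite (frame_dot fe) d eqSS ltnS.
Qed.

(** A vector is split off, and the construction goes on in its orthogonal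
    complement.  With a trivial relation [B] this is Gram-Schmidt; with
    orthogonality of the projections on [W] it diagonalises [P_V P_W]. *)
Lemma frame_rec (B : vec -> vec -> Prop) :
  (forall V, (0 < \dim V)%N -> exists v, [/\ v \in V, nrm2 v = 1 &
     forall w, w \in V -> dot w v = 0 -> B v w]) ->
  forall V, exists e, frame V e /\
    forall i j, (i < j)%N -> (i < \dim V)%N -> B (e i) (e j).
Proof.
move=> hB V; move: {2}(\dim V) (erefl (\dim V)) => d; elim: d V => [|d IH] V dV.
  exists (fun _ => 0); split=> [|i j]; last by rewrite dV.
  by split=> [i|i j]; rewrite ?mem0v // dot0l dV andbF.
have V0 : (0 < \dim V)%N by rewrite dV.
have [v [vV v1 vB]] := hB V V0.
have f1 := frame_scons vV v1.
have dX : \dim (V :&: orthc <[v]>)%VS = d.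
  have vNo : v \notin orthc V.
    apply/negP => /orthcP/(_ _ vV); rewrite dot_nrm1 // => /eqP.
    by rewrite oner_eq0.
  by rewrite /orthc -(eq_dim_orthov1 vNo) dV.
have [e [fe eB]] := IH _ dX.
exists (fun i => if i is j.+1 then e j else v); split; first exact: f1.
move=> [|i] [|j] //=; rewrite dV ltnS.
  move=> _ _; have := frame_mem fe j; rewrite memv_cap => /andP[eV /orthcP eo].
  by apply: vB => //; apply: eo; exact: memv_line.
by move=> ij id; apply: eB; rewrite ?dX.
Qed.

Lemma frame_exists V : exists e, frame V e.
Proof.
have [//|e [fe _]] := @frame_rec (fun _ _ => True) _ V; last by exists e.
move=> X; rewrite lt0n dimv_eq0 => X0; exists (normalize (vpick X)); split=> //.
  by apply: rpredZ; exact: memv_pick.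
by rewrite nrm2_normalize // vpick0.
Qed.

Lemma proj_sum W (I : Type) (r : seq I) (P : pred I) (h : I -> vec) :
  orthoproj W (\sum_(i <- r | P i) h i) =
  \sum_(i <- r | P i) orthoproj W (h i).
Proof. exact: linear_sum. Qed.

Lemma projZ W a u : orthoproj W (a *: u) = a *: orthoproj W u.
Proof. exact: linearZ. Qed.

(** An eigenvector of [P_V P_W] on [V] works: the left-hand side below is
    [dot (P_V P_W v) w], a multiple of [dot v w]. *)
Lemma proj_eigen V W : (0 < \dim V)%N ->
  exists v, [/\ v \in V, nrm2 v = 1 & forall w, w \in V -> dot w v = 0 ->
     dot (orthoproj W v) (orthoproj W w) = 0].
Proof.
move=> V0; have [b fb] := frame_exists V.
pose A : 'M[F]_(\dim V) :=
  \matrix_(i, j) dot (orthoproj W (b i)) (orthoproj W (b j)).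
have hA : selfadjoint_mx A by move=> i j; rewrite !mxE dotC.
have [a /eigenvalueP[c cA c0]] := selfadjoint_eigen V0 hA.
pose v : vec := \sum_i c 0 i *: b i.
have vV : v \in V by apply: rpred_sum => i _; rewrite rpredZ // (frame_mem fb).
have vb (i : 'I_(\dim V)) : dot v (b i) = c 0 i.
  rewrite dot_suml (bigD1 i) //= big1 => [|j ji].
    by rewrite dotZl (frame_dot fb) eqxx ltn_ord mulr1 addr0.
  by rewrite dotZl (frame_dot fb) val_eqE (negPf ji) mulr0.
have v0 : v != 0.
  apply: contra_neq c0 => v0; apply/rowP => i.
  by rewrite -vb v0 dot0l mxE.
have Pv (j : 'I_(\dim V)) :
    dot (orthoproj W v) (orthoproj W (b j)) = a * c 0 j.
  have := congr1 (fun M : 'rV_(\dim V) => M 0 j) cA; rewrite !mxE => <-.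
  rewrite proj_sum dot_suml; apply: eq_bigr => i _.
  by rewrite projZ dotZl !mxE.
clearbody v; exists (normalize v); split; first exact: rpredZ.
  exact: nrm2_normalize.
move=> w wV; rewrite dotZr => /eqP; rewrite mulf_eq0 => /orP[|/eqP wv].
  rewrite fmorph_eq0 -(rmorph0 (@of_real R k)) (inj_eq (@of_real_inj R k)).
  by rewrite invr_eq0 sqrtr_eq0 leNgt nrm2_gt0.
rewrite projZ dotZl {1}(frame_expand fb wV) proj_sum dot_sumr.
rewrite (eq_bigr (fun i : 'I__ => a * (c 0 i * sconj (dot w (b i))))); last first.
  by move=> i _; rewrite projZ dotZr Pv; ring.
rewrite -mulr_sumr (eq_bigr (fun i : 'I__ => dot v (b i) * sconj (dot w (b i)))).
  by rewrite -(parseval w fb vV) (dot_eq0C wv) !mulr0.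
by move=> i _; rewrite vb.
Qed.

(** A singular value decomposition of the projection [V -> W], in the form of a
    diagonal Gram matrix because this is visibly symmetric in [V] and [W].  The
    singular values are extended by zero, hence the angles [acos (s i)] by
    [pi / 2], which is the convention that the trace inequality requires. *)
Definition principal V W (s : nat -> R) e g : Prop :=
  [/\ frame V e, frame W g, forall i, 0 <= s i,
      forall i j, (i <= j)%N -> s j <= s i
    & forall i j, dot (e i) (g j) = of_real k (s i) *+ (i == j)].

Lemma principal_sym V W s e g : principal V W s e g -> principal W V s g e.
Proof.
move=> [fe fg s0 sd h]; split=> // i j; rewrite dotC h rmorphMn /= sconj_real.
by rewrite eq_sym; case: eqP => // ->.
Qed.

(** The right singular vectors of the projection [V -> W].  The recursion yields
    them in no particular order, whence the sorting. *)
Lemma principal_left V W : exists e, [/\ frame V e,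
  forall i j, i != j -> dot (orthoproj W (e i)) (orthoproj W (e j)) = 0
  & forall i j, (i <= j)%N ->
     nrm2 (orthoproj W (e j)) <= nrm2 (orthoproj W (e i))].
Proof.
have [|e [fe eB]] := @frame_rec
  (fun v w => dot (orthoproj W v) (orthoproj W w) = 0) _ V.
  by move=> X /(@proj_eigen X W)[v hv]; exists v.
have eo i j : i != j -> dot (orthoproj W (e i)) (orthoproj W (e j)) = 0.
  rewrite neq_ltn.
  have [id|id] := ltnP i (\dim V); last first.
    by rewrite (frame_default fe id) linear0 dot0l.
  have [jd|jd] := ltnP j (\dim V); last first.
    by rewrite (frame_default fe jd) linear0 dot0r.
  by move=> /orP[ij|ji]; [exact: eB|apply: dot_eq0C; exact: eB].
pose q i := nrm2 (orthoproj W (e i)).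
pose le : rel nat := fun i j => q j <= q i.
pose d := \dim V; pose t := sort le (iota 0 d).
have szt : size t = d by rewrite size_sort size_iota.
have tlt i : (i < d)%N -> (nth d t i < d)%N.
  move=> id; have : nth d t i \in t by rewrite mem_nth ?szt.
  by rewrite mem_sort mem_iota.
have tinj i j : (i < d)%N -> (j < d)%N -> (nth d t i == nth d t j) = (i == j).
  by move=> id jd; rewrite nth_uniq ?szt // sort_uniq iota_uniq.
have tdef i : (d <= i)%N -> e (nth d t i) = 0.
  by move=> di; rewrite nth_default ?szt // (frame_default fe).
exists (fun i => e (nth d t i)); split.
- split=> [i|i j]; first exact: frame_mem.
  have [id|id] := ltnP i d; last by rewrite (tdef i id) dot0l andbF.
  have [jd|jd] := ltnP j d; last first.
    rewrite (tdef j jd) dot0r; case: eqP => // ij.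
    by rewrite -ij leqNgt id in jd.
  by rewrite (frame_dot fe) tinj // tlt.
- move=> i j ij; have [id|id] := ltnP i d; last by rewrite (tdef i id) linear0 dot0l.
  have [jd|jd] := ltnP j d; last by rewrite (tdef j jd) linear0 dot0r.
  by apply: eo; rewrite tinj.
move=> i j ij; have [jd|jd] := ltnP j d; last first.
  by rewrite (tdef j jd) linear0 {1}/nrm2 dot0l raddf0 nrm2_ge0.
have id := leq_ltn_trans ij jd.
have le_tr : transitive le by move=> a b c ba ac; exact: le_trans ac ba.
have le_refl : reflexive le by move=> a; exact: lexx.
have le_tot : total le by move=> a b; rewrite /le le_total.
apply: (sorted_leq_nth le_tr le_refl d (sort_sorted le_tot _)) => //.
- by rewrite inE szt.
- by rewrite inE szt.
Qed.

(** The projections on [W] of the vectors found in [V] are orthogonal, with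
    lengths the singular values; the nonzero ones, normalised, are completed to
    a basis of [W]. *)
Lemma principal_exists V W : exists s e g, principal V W s e g.
Proof.
have [e [fe eo el]] := principal_left V W.
pose s i := Num.sqrt (nrm2 (orthoproj W (e i))).
have s0 i : 0 <= s i by exact: sqrtr_ge0.
have sd i j : (i <= j)%N -> s j <= s i by move=> ij; rewrite ler_wsqrtr ?el.
have sqs i : s i ^+ 2 = nrm2 (orthoproj W (e i)) by rewrite sqr_sqrtr ?nrm2_ge0.
have s_eq0 i : s i = 0 -> orthoproj W (e i) = 0.
  by move=> si; apply: nrm2_eq0; rewrite -sqs si expr0n.
have sV i : (\dim V <= i)%N -> s i = 0.
  move=> di; rewrite /s (frame_default fe di) linear0 /nrm2 dot0l raddf0.
  exact: sqrtr0.
(* [m] is the rank of the projection [V -> W]. *)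
have [m [mW m1 m2]] : exists m, [/\ (m <= \dim V)%N,
    forall i, (i < m)%N -> 0 < s i & forall i, (m <= i)%N -> s i = 0].
  have ex : exists i, s i == 0 by exists (\dim V); rewrite sV.
  exists (ex_minn ex); case: ex_minnP => m /eqP sm mmin; split.
  - by apply: mmin; rewrite sV.
  - move=> i im; rewrite lt_def s0 andbT; apply/negP => si0.
    by have := mmin _ si0; rewrite leqNgt im.
  - by move=> i mi; apply/eqP; rewrite eq_le s0 -sm sd.
pose g0 i := if (i < m)%N then of_real k (s i)^-1 *: orthoproj W (e i) else 0.
have Pe i : orthoproj W (e i) = of_real k (s i) *: g0 i.
  rewrite /g0; case: ltnP => im; last by rewrite scaler0 s_eq0 // m2.
  rewrite scalerA -rmorphM mulfV ?rmorph1 ?scale1r // gt_eqF //.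
  exact: m1.
have dg0 i j : dot (g0 i) (g0 j) = ((i == j) && (i < m)%N)%:R.
  rewrite /g0; case: (ltnP i m) => im; last by rewrite dot0l andbF.
  case: (ltnP j m) => jm; last first.
    by rewrite dot0r; case: eqP => // ij; rewrite ij ltnNge jm in im.
  rewrite dotZl dotZr; case: (eqVneq i j) => [<-|ij]; last by rewrite eo // !mulr0.
  have si : s i != 0 by rewrite gt_eqF // m1.
  rewrite -nrm2E -sqs sconj_real -!rmorphM /=.
  rewrite (_ : _ * _ = 1) ?rmorph1 //; by field.
have [dG fG] := frame_spanned dg0.
set G := spanned m g0 in dG fG.
have GW : (G <= W)%VS.
  apply/span_subvP => x /mapP[i _ ->]; rewrite /g0; case: ifP => _; rewrite ?mem0v //.
  by rewrite rpredZ // orthoproj_mem.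
have [g1 fg1] := frame_exists (W :&: orthc G)%VS.
have dW : (\dim W = m + \dim (W :&: orthc G))%N.
  have := dimv_sum_cap W (orthc G); have := orthcK_dim G.
  have -> : (W + orthc G)%VS = fullv.
    by apply: subv_anti; rewrite subvf -(addv_orthc G) addvS.
  by rewrite dimvf /dim /= mul1n dG; lia.
have og i j : dot (g0 i) (g1 j) = 0.
  apply: dot_eq0C; have := frame_mem fg1 j; rewrite memv_cap => /andP[_ /orthcP].
  by apply; exact: frame_mem fG i.
pose g i := if (i < m)%N then g0 i else g1 (i - m)%N.
exists s, e, g; split=> //.
  split=> [i|i j].
    rewrite /g; case: ifP => _; first exact: (subvP GW _ (frame_mem fG i)).
    by have := frame_mem fg1 (i - m); rewrite memv_cap => /andP[].
  rewrite /g; case: ltnP => im; case: ltnP => jm.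
  - by rewrite dg0 im dW (ltn_addr _ im).
  - by rewrite og; case: eqP => // ij; rewrite ij ltnNge jm in im.
  - by rewrite (dot_eq0C (og _ _)); case: eqP => // ij; rewrite ij leqNgt jm in im.
  - by rewrite (frame_dot fg1) dW; congr (_ && _)%:R; lia.
move=> i j; rewrite -(proj_dot (W := W)); last first.
  rewrite /g; case: ifP => _; first exact: (subvP GW _ (frame_mem fG j)).
  by have := frame_mem fg1 (j - m); rewrite memv_cap => /andP[].
rewrite Pe dotZl /g; case: ltnP => jm.
  rewrite dg0; case: (eqVneq i j) => [->|_]; first by rewrite jm mulr1.
  by rewrite mulr0.
rewrite og mulr0; case: (eqVneq i j) => // ->.
by rewrite m2 // rmorph0.
Qed.

End Principal.

(** * Principal angles and the asymmetric distance *)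

Section Angles.
Variables (R : realType) (k : scalars) (n : nat).
Local Notation F := (fld R k).
Local Notation vec := 'rV[F]_n.
Local Notation dot := (@dot R k n).
Implicit Types (u v w x y : vec) (U V W : Gr R k n) (e f g : nat -> vec).

Lemma principal_proj V W s e g : principal V W s e g ->
  forall i, orthoproj W (e i) = of_real k (s i) *: g i.
Proof.
move=> [fe fg _ _ h] i; rewrite (proj_frame _ fg).
have [iW|iW] := ltnP i (\dim W); last first.
  rewrite (frame_default fg iW) scaler0 big1 // => j _.
  by rewrite h (gtn_eqF (leq_trans (ltn_ord j) iW)) scale0r.
rewrite (bigD1 (Ordinal iW)) //= big1 => [|j ji].
  by rewrite h eqxx addr0.
by rewrite h (_ : _ == _ = false) ?scale0r // eq_sym; apply/negbTE.
Qed.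

Lemma principal_dot V W s e g v : principal V W s e g -> v \in V ->
  forall i, dot v (g i) = of_real k (s i) * dot v (e i).
Proof.
move=> H vV i; rewrite dotC -(proj_dot _ vV) -dotC.
by rewrite (principal_proj (principal_sym H)) dotZr sconj_real.
Qed.

Lemma nrm2_principal V W s e g v : principal V W s e g -> v \in V ->
  nrm2 (orthoproj W v) =
  \sum_(i < \dim V) s i ^+ 2 * sqn (dot v (e i)).
Proof.
move=> H vV; have [fe fg _ _ h] := H.
rewrite /nrm2 proj_dot ?orthoproj_mem //.
rewrite {2}(frame_expand fe vV) proj_sum dot_sumr raddf_sum /=.
apply: eq_bigr => i _.
rewrite projZ dotZr (principal_proj H) dotZr sconj_real (principal_dot H vV).
rewrite -[RHS](of_realK k) [in RHS]rmorphM [in RHS]rmorphXn /= sqnE.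
by congr (rpart _); ring.
Qed.

Lemma principal_s0 V W s e g i : principal V W s e g ->
  (minn (\dim V) (\dim W) <= i)%N -> s i = 0.
Proof.
move=> [fe fg _ _ h]; rewrite geq_min => le.
have hi : of_real k (s i) = dot (e i) (g i) by rewrite h eqxx.
apply: (@of_real_inj R k); rewrite rmorph0 hi.
by case/orP: le => le; rewrite ?(frame_default fe le) ?(frame_default fg le)
  ?dot0l ?dot0r.
Qed.

Lemma principal_le1 V W s e g i : principal V W s e g -> s i <= 1.
Proof.
move=> [fe fg s0 _ h]; rewrite -(@expr_le1 _ 2) //.
have hi : of_real k (s i) = dot (e i) (g i) by rewrite h eqxx.
rewrite -(sqn_real k) hi.
apply: le_trans (frame_nrm2_le1 fe i); apply: le_trans (frame_bessel i.+1 _ fg).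
by rewrite big_ord_recr /= lerDr sumr_ge0 // => j _; exact: sqn_ge0.
Qed.

(** Courant-Fischer: a dimension count gives a vector of [V] on which the
    projection to [W'] stretches by at least [s' m], and the one to [W] by at
    most [s m]. *)
Lemma principal_compare V W W' s s' e e' g g' :
  principal V W s e g -> principal V W' s' e' g' ->
  (forall v, v \in V -> nrm2 (orthoproj W' v) <= nrm2 (orthoproj W v)) ->
  forall m, s' m <= s m.
Proof.
move=> H H' le m; have [fe _ s0 sd _] := H; have [fe' _ s0' sd' _] := H'.
have [mV|mV] := ltnP m (\dim V); last first.
  by rewrite (principal_s0 H') // (leq_trans (geq_minl _ _)).
pose ws := mkseq e m ++ [seq e' i | i <- iota m.+1 (\dim V - m.+1)].
have [|v [vV v0 vo]] := @exists_orthogonal _ _ _ V ws.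
  by rewrite size_cat size_mkseq size_map size_iota; lia.
have := le v vV; rewrite (nrm2_principal H vV) (nrm2_principal H' vV).
have lo : s' m ^+ 2 * nrm2 v <= \sum_(i < \dim V) s' i ^+ 2 * sqn (dot v (e' i)).
  rewrite (nrm2_frame fe' vV) mulr_sumr; apply: ler_sum => i _.
  have [im|im] := leqP i m.
    by rewrite ler_wpM2r ?sqn_ge0 // lerXn2r ?nnegrE // sd'.
  rewrite [dot _ _]vo ?sqn0 ?mulr0 // mem_cat; apply/orP; right.
  by apply: map_f; rewrite mem_iota subnKC // im ltn_ord.
have hi : \sum_(i < \dim V) s i ^+ 2 * sqn (dot v (e i)) <= s m ^+ 2 * nrm2 v.
  rewrite (nrm2_frame fe vV) mulr_sumr; apply: ler_sum => i _.
  have [im|im] := ltnP i m; last first.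
    by rewrite ler_wpM2r ?sqn_ge0 // lerXn2r ?nnegrE // sd.
  rewrite [dot _ _]vo ?sqn0 ?mulr0 // mem_cat; apply/orP; left.
  by apply: map_f; rewrite mem_iota.
move=> mid; have := le_trans lo (le_trans mid hi).
by rewrite ler_pM2r ?nrm2_gt0 // ler_pXn2r ?nnegrE.
Qed.

Lemma singular_values_principal V W (t : seq R) :
  singular_values V W (orthoproj W) t ->
  exists e g, principal V W (nth 0 t) e g.
Proof.
move=> [st so t0 [e [g [/orthonormal_basis_frame[_ fe]]]]].
move=> /orthonormal_basis_frame[_ fg] h.
have tdef i : (minn (\dim V) (\dim W) <= i)%N -> t`_i = 0.
  by move=> le; rewrite nth_default // st.
exists (nth 0 e), (nth 0 g); split=> // [i j ij|i j].
  have [jt|jt] := ltnP j (size t); last by rewrite (nth_default _ jt).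
  apply: (sorted_leq_nth ge_trans (@lexx _ R)) => //; rewrite inE //.
  exact: leq_ltn_trans ij jt.
have [iV|iV] := ltnP i (\dim V); last first.
  rewrite (frame_default fe iV) dot0l tdef ?rmorph0 ?mul0rn //.
  by rewrite geq_min iV.
rewrite -(proj_dot _ (frame_mem fg j)) h // dotZl (frame_dot fg).
case: eqP => // _ /=; last by rewrite mulr0.
case: ltnP => iW; first by rewrite mulr1.
by rewrite mulr0 tdef ?rmorph0 // geq_min iW orbT.
Qed.

Lemma principal_singular_values V W s e g : principal V W s e g ->
  singular_values V W (orthoproj W) (mkseq s (minn (\dim V) (\dim W))).
Proof.
move=> H; have [fe fg s0 sd h] := H.
have nE i : (mkseq s (minn (\dim V) (\dim W)))`_i = s i.
  have [lt|ge] := ltnP i (minn (\dim V) (\dim W)); first by rewrite nth_mkseq.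
  by rewrite nth_default ?size_mkseq // (principal_s0 H).
have feE X (f : nat -> vec) (i : nat) : frame X f -> (mkseq f (\dim X))`_i = f i.
  move=> fX; have [lt|ge] := ltnP i (\dim X); first by rewrite nth_mkseq.
  by rewrite nth_default ?size_mkseq // (frame_default fX).
split; first by rewrite size_mkseq.
- apply: (@path.homo_sorted _ _ s ltn); last exact: iota_ltn_sorted.
  by move=> i j /ltnW; exact: sd.
- by move=> i; rewrite nE.
exists (mkseq e (\dim V)), (mkseq g (\dim W)).
split; try exact: frame_orthonormal_basis.
by move=> i _; rewrite nE !feE // (principal_proj H).
Qed.

(** Singular values are unique by [principal_compare], so the choice made in
    [principal_angles] is immaterial. *)
Lemma dgE V W s e g : principal V W s e g -> (\dim V <= \dim W)%N ->
  dg V W = Num.sqrt (\sum_(i < \dim V) acos (s i) ^+ 2).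
Proof.
move=> H VW; rewrite /dg VW /principal_angles.
case: eqP => [->|_]; first by rewrite big_ord0 sqrtr0.
set t := xget _ _.
have ht : singular_values V W (orthoproj W) t.
  by apply: (xgetPex [::]); eexists; exact: principal_singular_values H.
have [e' [g' H']] := singular_values_principal ht.
have st i : t`_i = s i.
  by apply/eqP; rewrite eq_le (principal_compare H H') // (principal_compare H' H).
have sz : size t = \dim V by case: ht => -> *; exact/minn_idPl.
congr Num.sqrt; apply: eq_bigr => i _.
by rewrite (nth_map 0) ?sz // st.
Qed.

Lemma acos_anti (x y : R) : -1 <= x -> x <= y -> y <= 1 -> acos y <= acos x.
Proof.
move=> x1 xy y1; rewrite leNgt; apply/negP => lt.
have xI : -1 <= x <= 1 by rewrite x1 (le_trans xy).
have yI : -1 <= y <= 1 by rewrite y1 (le_trans x1).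
have := lt; rewrite -ltr_cos ?in_itv /= ?acos_ge0 ?acos_lepi //.
by rewrite !acosK ?in_itv //= ltNge xy.
Qed.

Lemma acos_pihalf (x : R) : 0 <= x <= 1 -> 0 <= acos x <= pi / 2.
Proof.
move=> /andP[x0 x1]; rewrite acos_ge0 ?x1 ?andbT ?(le_trans _ x0) ?lerN10 //=.
by rewrite -acos0 acos_anti ?lerN10.
Qed.

Lemma acos_principal V W s e g i : principal V W s e g ->
  0 <= acos (s i) <= pi / 2.
Proof.
move=> H; apply: acos_pihalf; rewrite (principal_le1 _ H) andbT.
by case: H.
Qed.

Lemma acos_sorted V W s e g i j : principal V W s e g -> (i <= j)%N ->
  acos (s i) <= acos (s j).
Proof.
move=> H ij; have [_ _ s0 sd _] := H.
apply: acos_anti; [exact: le_trans (lerN10 _) (s0 j)|exact: sd|].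
exact: principal_le1 H.
Qed.

Lemma pihalf_gt0 : 0 < pi / 2 :> R.
Proof. by rewrite divr_gt0 // pi_gt0. Qed.

Lemma Delta_sqrt p : Delta R p = Num.sqrt (\sum_(i < p) (pi / 2) ^+ 2).
Proof.
rewrite sumr_const card_ord -[_ *+ p]mulr_natr sqrtrM ?sqr_ge0 // sqrtr_sqr ger0_norm //.
exact: ltW pihalf_gt0.
Qed.

Lemma Delta_le p q : (Delta R p <= Delta R q) = (p <= q)%N.
Proof.
by rewrite /Delta ler_pM2l ?pihalf_gt0 // ler_sqrt ?ler_nat.
Qed.

Lemma Delta_inj : injective (Delta R).
Proof. by move=> p q E; apply/eqP; rewrite eqn_leq -!Delta_le E lexx. Qed.

Lemma Delta_gt0 p : (0 < p)%N -> 0 < Delta R p.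
Proof. by move=> p0; rewrite mulr_gt0 ?pihalf_gt0 // sqrtr_gt0 ltr0n. Qed.

Lemma dg_ge0 V W : 0 <= dg V W.
Proof.
rewrite /dg; case: eqP => // _; case: ifP => _; first exact: sqrtr_ge0.
by rewrite mulr_ge0 ?sqrtr_ge0 // ltW // pihalf_gt0.
Qed.

Lemma dg_gtdim V W : (\dim W < \dim V)%N -> dg V W = Delta R (\dim V).
Proof. by move=> lt; rewrite /dg leqNgt lt gtn_eqF // (leq_ltn_trans _ lt). Qed.

Lemma dg_le_Delta V W : dg V W <= Delta R (\dim V).
Proof.
have [VW|WV] := leqP (\dim V) (\dim W); last by rewrite dg_gtdim.
have [s [e [g H]]] := principal_exists V W.
rewrite (dgE H VW) Delta_sqrt ler_wsqrtr // ler_sum // => i _.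
by have /andP[h0 h1] := acos_principal i H; rewrite lerXn2r // nnegrE // (le_trans h0).
Qed.

(** Projections on a larger subspace are longer, so each singular value grows. *)
Lemma dg_sub V W W' : (W' <= W)%VS -> dg V W <= dg V W'.
Proof.
move=> W'W; have [VW'|W'V] := leqP (\dim V) (\dim W'); last first.
  by rewrite (dg_gtdim W'V) dg_le_Delta.
have VW := leq_trans VW' (dimvS W'W).
have [s [e [g H]]] := principal_exists V W.
have [s' [e' [g' H']]] := principal_exists V W'.
rewrite (dgE H VW) (dgE H' VW') ler_wsqrtr // ler_sum // => i _.
have [_ _ s0' _ _] := H'; have /andP[h0 _] := acos_principal i H.
have /andP[h1 _] := acos_principal i H'.
rewrite lerXn2r ?nnegrE // acos_anti //.
- exact: le_trans (lerN10 _) (s0' i).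
- apply: (principal_compare H H') => v vV.
  have [b fb] := frame_exists W'.
  rewrite [leLHS](_ : _ = nrm2 (orthoproj W' (orthoproj W v))).
    by rewrite (nrm2_proj _ fb); exact: frame_bessel fb.
  rewrite (nrm2_proj _ fb) (nrm2_proj _ fb); apply: eq_bigr => j _.
  by rewrite proj_dot // (subvP W'W) // (frame_mem fb).
- exact: principal_le1 H.
Qed.

(** The projections on [W'] and on [W] coincide on [V]. *)
Lemma dg_proj_subspace V W W' : (\dim V <= \dim W)%N -> proj_subspaces V W W' ->
  dg V W' = dg V W.
Proof.
move=> VW [W'W dW' PW'].
have VW' : (\dim V <= \dim W')%N by rewrite dW' leq_min leqnn.
have [s [e [g H]]] := principal_exists V W.
have [s' [e' [g' H']]] := principal_exists V W'.
rewrite (dgE H VW) (dgE H' VW'); congr Num.sqrt; apply: eq_bigr => i _.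
have E v : v \in V -> orthoproj W' v = orthoproj W v.
  move=> vV; apply: proj_unique; first by apply: (subvP PW'); exact: memv_img.
  move=> x /(subvP W'W) xW; have /orthcP := orthoproj_orthc W v; exact.
have -> // : s' i = s i.
apply/eqP; rewrite eq_le (principal_compare H H') ?(principal_compare H' H) //.
  by move=> v vV; rewrite E.
by move=> v vV; rewrite E.
Qed.

Lemma acos_eq0 (x : R) : 0 <= x <= 1 -> acos x = 0 -> x = 1.
Proof.
move=> /andP[x0 x1] h; rewrite -(acosK (x := x)) ?h ?cos0 // in_itv /= x1 andbT.
exact: le_trans (lerN10 _) x0.
Qed.

Lemma acos_eq_pihalf (x : R) : 0 <= x <= 1 -> acos x = pi / 2 -> x = 0.
Proof.
move=> /andP[x0 x1] h; rewrite -(acosK (x := x)) ?h ?cos_pihalf // in_itv /= x1 andbT.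
exact: le_trans (lerN10 _) x0.
Qed.

(** All angles vanish when all the principal vectors coincide, that is, when
    those of [V] lie in [W]. *)
Lemma dg_eq0P V W : dg V W = 0 <-> (V <= W)%VS.
Proof.
have [s [e [g H]]] := principal_exists V W; have [fe fg s0 _ h] := H.
have s01 i : 0 <= s i <= 1 by rewrite s0 (principal_le1 _ H).
split=> [d0|VW].
  have VW : (\dim V <= \dim W)%N.
    rewrite leqNgt; apply/negP => lt; move: d0; rewrite dg_gtdim // => /eqP.
    by rewrite gt_eqF // Delta_gt0 // (leq_ltn_trans _ lt).
  have : \sum_(i < \dim V) acos (s i) ^+ 2 = 0.
    apply/eqP; rewrite eq_le sumr_ge0 ?andbT => [|i _]; last exact: sqr_ge0.
    by rewrite -sqrtr_eq0 -(dgE H VW) d0.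
  move/eqP; rewrite psumr_eq0 => [|i _]; last exact: sqr_ge0.
  move=> /allP a0; apply/subvP => v vV; rewrite (frame_expand fe vV).
  apply: rpred_sum => i _; apply: rpredZ.
  have := a0 i (mem_index_enum i); rewrite /= sqrf_eq0 => /eqP/acos_eq0 -/(_ (s01 i)) s1.
  suff -> : e i = g i by exact: (frame_mem fg).
  apply/eqP; rewrite -subr_eq0; apply/eqP/dot_eq0.
  have eg : dot (e i) (g i) = 1 by rewrite h eqxx s1 rmorph1.
  rewrite dotBl !dotBr [dot (g i) (e i)]dotC eg rmorph1 (frame_dot fe) (frame_dot fg).
  by rewrite !eqxx ltn_ord (leq_trans (ltn_ord i) VW) /= subrr.
rewrite (dgE H (dimvS VW)) big1 ?sqrtr0 // => i _.
suff -> : s i = 1 by rewrite acos1 expr0n.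
have eW : e i \in W by apply: (subvP VW); exact: (frame_mem fe).
apply/eqP; rewrite -(@eqrXn2 _ 2) // expr1n; apply/eqP.
have := nrm2_principal H (frame_mem fe i).
rewrite (proj_id eW) (bigD1 i) //= big1 => [|j ji]; last first.
  by rewrite (frame_dot fe) eq_sym val_eqE (negPf ji) sqn0 mulr0.
rewrite /nrm2 (frame_dot fe) eqxx ltn_ord /= addr0.
by rewrite -(rmorph1 (@of_real R k)) of_realK sqn_real expr1n mulr1.
Qed.

Lemma dgxx V : dg V V = 0.
Proof. by apply/dg_eq0P. Qed.

(** When [\dim V <= \dim W], the maximum is attained when all angles are right. *)
Lemma dg_eq_DeltaP V W :
  dg V W = Delta R (\dim V) <-> perp V W \/ (\dim W < \dim V)%N.
Proof.
have [VW|WV] := leqP (\dim V) (\dim W); last by split=> _; [right|exact: dg_gtdim].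
have [s [e [g H]]] := principal_exists V W; have [fe fg s0 _ h] := H.
have s01 i : 0 <= s i <= 1 by rewrite s0 (principal_le1 _ H).
split=> [|[/perpP VoW|//]].
  rewrite (dgE H VW) Delta_sqrt => /eqP; rewrite eqr_sqrt; first last.
  - by apply: sumr_ge0 => i _; exact: sqr_ge0.
  - by apply: sumr_ge0 => i _; exact: sqr_ge0.
  rewrite eq_sym -subr_eq0 -sumrB psumr_eq0 => [/allP a0|i _]; last first.
    have /andP[h0 h1] := acos_principal i H.
    by rewrite subr_ge0 lerXn2r // nnegrE // (le_trans h0).
  left; apply/perpP => v w vV wW.
  have s00 (i : 'I_(\dim V)) : s i = 0.
    apply: acos_eq_pihalf => //; have := a0 i (mem_index_enum i).
    have /andP[h0 h1] := acos_principal i H.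
    by rewrite /= subr_eq0 eqrXn2 // ?(le_trans h0) // => /eqP.
  rewrite -(proj_dot _ wW) (frame_expand fe vV) proj_sum dot_suml big1 // => i _.
  by rewrite projZ (principal_proj H) s00 rmorph0 scale0r scaler0 dot0l.
rewrite (dgE H VW) Delta_sqrt; congr Num.sqrt; apply: eq_bigr => i _.
suff -> : s i = 0 by rewrite acos0.
apply: (@of_real_inj R k); rewrite rmorph0 -(VoW (e i) (g i)) ?(frame_mem fe) ?(frame_mem fg) //.
by rewrite h eqxx.
Qed.

End Angles.

(** * Rearrangement, Minkowski and trigonometric inequalities *)

Section RealInequalities.
Variable R : realType.
Implicit Types (x y a b : nat -> R) (m : nat -> nat -> R).

(** Linear programming duality: [b] and [x * y - b] are nonnegative potentials
    for the transport problem with gain [x j * y l], tight on the diagonal.  The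
    potential [b] is a discrete integral of [x] against [y], and the last
    inequality is the discrete form of Young's inequality. *)
Lemma rearrangement_potential x y r :
  (forall i j, (i <= j)%N -> x j <= x i) -> (forall i j, (i <= j)%N -> y j <= y i) ->
  (forall i, 0 <= x i) -> (forall i, 0 <= y i) ->
  (forall i, (r <= i)%N -> x i = 0) -> (forall i, (r <= i)%N -> y i = 0) ->
  exists b, [/\ forall i, 0 <= b i, forall i, b i <= x i * y i
    & forall j l, x j * y l <= x j * y j - b j + b l].
Proof.
move=> xd yd x0 y0 xr yr.
pose b l := \sum_(l <= i < r) (y i - y i.+1) * x i.+1.
pose a l := \sum_(l <= i < r) (x i - x i.+1) * y i.
have bS l : b l - b l.+1 = (y l - y l.+1) * x l.+1.
  rewrite /b; have [lr|rl] := ltnP l r; first by rewrite big_ltn // addrK.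
  by rewrite !big_geq ?yr ?subrr ?mul0r ?(leq_trans rl).
have abE l : a l + b l = x l * y l.
  rewrite /a /b -big_split /=.
  have [lr|rl] := leqP l r; last by rewrite big_geq ?xr ?mul0r // ltnW.
  rewrite (@telescope_sumr_eq R l r (fun i => - (x i * y i)) _ lr).
    by rewrite xr // mul0r oppr0 sub0r opprK.
  by move=> i _; ring.
have dy l : 0 <= y l - y l.+1 by rewrite subr_ge0 yd.
have dx l : 0 <= x l - x l.+1 by rewrite subr_ge0 xd.
exists b; split.
- by move=> i; apply: sumr_ge0 => j _; rewrite mulr_ge0.
- by move=> i; rewrite -abE lerDr sumr_ge0 // => j _; rewrite mulr_ge0.
move=> j l; suff : b j - x j * y j <= b l - x j * y l by lra.
have [/subnKC <-|/ltnW/subnKC jE] := leqP j l.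
  elim: (l - j)%N => [|d IH]; first by rewrite addn0.
  apply: le_trans IH _; rewrite addnS; have := bS (j + d)%N.
  have : 0 <= (y (j + d)%N - y (j + d).+1) * (x j - x (j + d).+1).
    by rewrite mulr_ge0 // subr_ge0 xd // leqW // leq_addr.
  lra.
suff h d i : (i + d)%N = j -> b j - x j * y j <= b i - x j * y i by exact: h jE.
elim: d i => [|d IH] i; first by rewrite addn0 => ->.
rewrite addnS -addSn => /[dup] iE /IH; move/le_trans; apply.
have := bS i; have : 0 <= (y i - y i.+1) * (x i.+1 - x j).
  by rewrite mulr_ge0 // subr_ge0 xd // -iE leq_addr.
lra.
Qed.

(** Weak duality with the potentials of [rearrangement_potential]: the weights
    have row and column sums at most 1. *)
Lemma rearrangement x y r m :
  (forall i j, (i <= j)%N -> x j <= x i) -> (forall i j, (i <= j)%N -> y j <= y i) ->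
  (forall i, 0 <= x i) -> (forall i, 0 <= y i) ->
  (forall i j, 0 <= m i j) ->
  (forall i, \sum_(j < r) m i j <= 1) -> (forall j, \sum_(i < r) m i j <= 1) ->
  \sum_(i < r) \sum_(j < r) m i j * (x i * y j) <= \sum_(i < r) x i * y i.
Proof.
move=> xd yd x0 y0 m0 mr mc.
(* The potentials require sequences vanishing from [r] on. *)
pose t z (i : nat) : R := if (i < r)%N then z i else 0.
have tE z (i : 'I_r) : t z i = z i by rewrite /t ltn_ord.
have td z : (forall i j, (i <= j)%N -> z j <= z i) -> (forall i, 0 <= z i) ->
    forall i j, (i <= j)%N -> t z j <= t z i.
  move=> zd z0 i j ij; rewrite /t; case: (ltnP j r) => jr.
    by rewrite (leq_ltn_trans ij jr) zd.
  by case: ifP.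
have t0 z : (forall i, 0 <= z i) -> forall i, 0 <= t z i.
  by move=> z0 i; rewrite /t; case: ifP.
have tr z i : (r <= i)%N -> t z i = 0 by rewrite /t ltnNge => ->.
have [b [b0 bxy pot]] := rearrangement_potential (td x xd x0) (td y yd y0)
  (t0 x x0) (t0 y y0) (tr x) (tr y).
have -> : \sum_(i < r) x i * y i =
    \sum_(i < r) (x i * y i - b i) + \sum_(i < r) b i.
  by rewrite -big_split /=; apply: eq_bigr => i _; rewrite subrK.
apply: (@le_trans _ _ (\sum_(i < r) \sum_(j < r) m i j * (x i * y i - b i)
    + \sum_(j < r) \sum_(i < r) m i j * b j)).
  rewrite [X in _ <= _ + X]exchange_big -big_split /=; apply: ler_sum => i _.
  rewrite -big_split /=; apply: ler_sum => j _.
  rewrite -mulrDr ler_wpM2l //; have := pot i j; by rewrite !tE.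
apply: lerD; apply: ler_sum => i _; rewrite -mulr_suml.
  rewrite -[leRHS]mul1r ler_wpM2r // subr_ge0.
  by rewrite -(tE x) -(tE y); exact: bxy.
by rewrite -[leRHS]mul1r ler_wpM2r.
Qed.

(** Reversing the order of the indices reduces this to [rearrangement]. *)
Lemma rearrangement_nondecreasing x y r m :
  (forall i j, (i <= j)%N -> x i <= x j) -> (forall i j, (i <= j)%N -> y i <= y j) ->
  (forall i, 0 <= x i) -> (forall i, 0 <= y i) ->
  (forall i j, 0 <= m i j) ->
  (forall i, \sum_(j < r) m i j <= 1) -> (forall j, \sum_(i < r) m i j <= 1) ->
  \sum_(i < r) \sum_(j < r) m i j * (x i * y j) <= \sum_(i < r) x i * y i.
Proof.
move=> xd yd x0 y0 m0 mr mc.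
pose q i := (r - i.+1)%N.
have revE (f : nat -> R) : \sum_(i < r) f i = \sum_(i < r) f (q i).
  by rewrite (reindex_inj rev_ord_inj).
rewrite (revE (fun i => x i * y i)).
rewrite (revE (fun i => \sum_(j < r) m i j * (x i * y j))).
under eq_bigr do rewrite (revE (fun j => m _ j * (x _ * y j))).
apply: (@rearrangement (x \o q) (y \o q) r (fun i j => m (q i) (q j))) => //=.
- by move=> i j ij; apply: xd; rewrite /q; lia.
- by move=> i j ij; apply: yd; rewrite /q; lia.
- by move=> i; rewrite -(revE (m (q i))).
- by move=> j; rewrite -(revE (m^~ (q j))).
Qed.

(** Minkowski's inequality; [CC] is the Cauchy-Schwarz inequality, from Lagrange's
    identity. *)
Lemma l2_triangle a b r :
  Num.sqrt (\sum_(i < r) (a i + b i) ^+ 2) <=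
  Num.sqrt (\sum_(i < r) a i ^+ 2) + Num.sqrt (\sum_(i < r) b i ^+ 2).
Proof.
set A := \sum_(i < r) a i ^+ 2; set B := \sum_(i < r) b i ^+ 2.
have s0 (f : nat -> R) : 0 <= \sum_(i < r) f i ^+ 2.
  by apply: sumr_ge0 => i _; exact: sqr_ge0.
pose C := \sum_(i < r) a i * b i.
have expand (u v : R) :
    \sum_(i < r) (u * a i + v * b i) ^+ 2 = u ^+ 2 * A + 2 * (u * v * C) + v ^+ 2 * B.
  rewrite /A /B /C !mulr_sumr -!big_split /=; apply: eq_bigr => i _; ring.
have sA := sqr_sqrtr (s0 a); have sB := sqr_sqrtr (s0 b).
have sqA := sqrtr_ge0 A; have sqB := sqrtr_ge0 B.
rewrite -/A in sA; rewrite -/B in sB.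
have CAB : C <= Num.sqrt A * Num.sqrt B.
  have CC : C ^+ 2 <= A * B.
    have : 0 <= \sum_(i < r) \sum_(j < r) (- b i * a j + a i * b j) ^+ 2.
      by apply: sumr_ge0 => i _; exact: s0 (fun j => - b i * a j + a i * b j).
    under eq_bigr do rewrite expand.
    have E (p q t : R) : \sum_(i < r) ((- b i) ^+ 2 * p + 2 * (- b i * a i * t)
        + a i ^+ 2 * q) = (\sum_(i < r) b i ^+ 2) * p
        - 2 * ((\sum_(i < r) a i * b i) * t) + (\sum_(i < r) a i ^+ 2) * q.
      rewrite !mulr_suml mulr_sumr -sumrB -big_split /=.
      by apply: eq_bigr => i _; ring.
    by rewrite E -/A -/B -/C; lra.
  apply: le_trans (ler_norm C) _; rewrite -sqrtr_sqr -sqrtrM ?ler_wsqrtr //.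
  exact: s0.
have -> : \sum_(i < r) (a i + b i) ^+ 2 = A + 2 * C + B.
  have := expand 1 1; rewrite !expr1n !mul1r => <-.
  by apply: eq_bigr => i _; rewrite !mul1r.
rewrite -[leRHS]ger0_norm ?addr_ge0 // -sqrtr_sqr ler_wsqrtr //.
by rewrite sqrrD sA sB -mulr_natr; lra.
Qed.

Lemma sin_mean_value (y : R) : 0 <= y ->
  exists2 c, 0 <= c <= y & sin y = cos c * y.
Proof.
move=> y0; have [|c] := MVT_segment y0 (fun z _ => is_derive_sin z).
  by apply: continuous_subspaceT => z; exact: continuous_sin.
by rewrite in_itv /= sin0 !subr0 => cI ->; exists c.
Qed.

Lemma cos_mul_le_sin (y : R) : 0 <= y <= pi / 2 -> y * cos y <= sin y.
Proof.
move=> /andP[y0 y1]; have [c /andP[c0 cy] ->] := sin_mean_value y0.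
rewrite mulrC ler_wpM2r //.
have pp : pi / 2 <= pi :> R by have := @pi_gt0 R; lra.
have [->//|cy'] := eqVneq c y.
have cI : c \in `[0, pi] by rewrite in_itv /= c0 (le_trans cy) // (le_trans y1).
have yI : y \in `[0, pi] by rewrite in_itv /= y0 (le_trans y1).
by apply: ltW; rewrite ltr_cos // lt_neqAle cy'.
Qed.

Lemma one_sub_cos (x : R) : 1 - cos x = 2 * sin (x / 2) ^+ 2.
Proof.
have -> : cos x = cos ((x / 2) *+ 2) by congr cos; rewrite -mulr_natr; field.
by rewrite cos_mulr2n cos2sin2 -mulr_natr; ring.
Qed.

Lemma chord_le_arc (x : R) : 2 * (1 - cos x) <= x ^+ 2.
Proof.
rewrite -cos_norm one_sub_cos; set y := `|x| / 2.
have y0 : 0 <= y by rewrite divr_ge0.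
have xE : x ^+ 2 = 4 * y ^+ 2 by rewrite -real_normK ?num_real // /y; field.
rewrite xE; have [c _ ->] := sin_mean_value y0; rewrite exprMn.
have c1 : cos c ^+ 2 <= 1 by have := cos2Dsin2 c; have := sqr_ge0 (sin c); lra.
have := ler_wpM2r (sqr_ge0 y) c1; lra.
Qed.

(** With [y = `|x| / 2] the chord is [2 * sin y >= 2 * y * cos y], and
    [cos y >= cos y ^+ 2 >= 1 - D ^+ 2 / 4]: short arcs are longer than their
    chords by a second order factor only. *)
Lemma arc_le_chord (x D : R) : `|x| <= pi / 2 -> 2 * (1 - cos x) <= D ^+ 2 ->
  0 <= 1 - D ^+ 2 / 4 -> (1 - D ^+ 2 / 4) ^+ 2 * x ^+ 2 <= 2 * (1 - cos x).
Proof.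
rewrite -cos_norm one_sub_cos; set y := `|x| / 2 => xpi.
have y0 : 0 <= y by rewrite divr_ge0.
have xE : x ^+ 2 = 4 * y ^+ 2 by rewrite -real_normK ?num_real // /y; field.
rewrite xE => hD c0; have p0 := @pi_gt0 R.
have yI : 0 <= y <= pi / 2 by rewrite y0 /=; rewrite /y; lra.
have cy0 : 0 <= cos y by apply: cos_ge0_pihalf; lra.
have cy1 := cos_le1 y; have := cos2Dsin2 y; have := cos_mul_le_sin yI.
move=> h1 h2.
have h3 : 1 - D ^+ 2 / 4 <= cos y.
  have : cos y ^+ 2 <= cos y by rewrite expr2 ler_piMl.
  lra.
have h4 : (1 - D ^+ 2 / 4) * y <= sin y.
  by apply: le_trans h1; rewrite [leRHS]mulrC ler_wpM2r.
have : ((1 - D ^+ 2 / 4) * y) ^+ 2 <= sin y ^+ 2.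
  by rewrite ler_pXn2r // nnegrE ?mulr_ge0 // (le_trans _ h4) // mulr_ge0.
rewrite exprMn; lra.
Qed.

End RealInequalities.

(** * The triangle inequality *)

Section Triangle.
Variables (R : realType) (k : scalars) (n : nat).
Local Notation F := (fld R k).
Local Notation vec := 'rV[F]_n.
Local Notation dot := (@dot R k n).
Implicit Types (u v w x y : vec) (U V W : Gr R k n) (e f g h : nat -> vec).

Lemma cos_principal V W s e g i : principal V W s e g -> cos (acos (s i)) = s i.
Proof.
move=> H; have [_ _ s0 _ _] := H.
by rewrite acosK // in_itv /= (principal_le1 _ H) andbT (le_trans (lerN10 _)).
Qed.

Lemma sin_principal_ge0 V W s e g i : principal V W s e g ->
  0 <= sin (acos (s i)).
Proof.
move=> H; have /andP[a0 a1] := acos_principal i H.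
by apply: sin_ge0_pi; rewrite a0 (le_trans a1) //; have := @pi_gt0 R; lra.
Qed.

(** The cosine-sine decomposition of the principal vectors of [U] along [V] and
    its orthogonal complement. *)
Lemma cosine_sine U V s e f : principal U V s e f -> exists h,
  [/\ forall i j, i != j -> dot (h i) (h j) = 0,
      forall i, nrm2 (h i) <= 1,
      forall i v, v \in V -> dot (h i) v = 0,
      forall i, e i = of_real k (s i) *: f i + of_real k (sin (acos (s i))) *: h i
    & forall i, (i < \dim U)%N -> sin (acos (s i)) != 0 -> nrm2 (h i) = 1].
Proof.
move=> H; have [fe ff s0 _ ef] := H.
pose S i := sin (acos (s i)); pose d i := e i - of_real k (s i) *: f i.
have S2 i : S i ^+ 2 = 1 - s i ^+ 2 by rewrite /S sin2cos2 (cos_principal _ H).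
have dV i v : v \in V -> dot (d i) v = 0.
  move=> vV; rewrite dotBl -(principal_proj H) proj_dot // subrr //.
have dd i j : dot (d i) (d j) = dot (e i) (e j) - of_real k (s i ^+ 2) *+ (i == j).
  rewrite {2}/d dotBr dotZr (dV i (f j)) ?(frame_mem ff) // mulr0 subr0 dotBl dotZl.
  rewrite [dot (f i) _]dotC ef eq_sym; case: eqP => [->|_]; last first.
    by rewrite !mulr0n rmorph0 mulr0.
  by rewrite !mulr1n sconj_real -rmorphM expr2.
have nd i : nrm2 (d i) = nrm2 (e i) - s i ^+ 2.
  apply: (@of_real_inj R k); rewrite nrm2E dd eqxx mulr1n -nrm2E.
  by rewrite -[RHS]/(of_real k _) rmorphB.
have nd_le i : nrm2 (d i) <= S i ^+ 2.
  by rewrite nd S2 lerD2r; exact: frame_nrm2_le1 fe i.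
have hn i : nrm2 (of_real k (S i)^-1 *: d i) = (S i)^-1 ^+ 2 * nrm2 (d i).
  by rewrite nrm2Z sqn_real.
exists (fun i => of_real k (S i)^-1 *: d i); split.
- move=> i j ij; rewrite dotZl dotZr dd (frame_ortho fe ij) (negPf ij).
  by rewrite mulr0n subr0 !mulr0.
- move=> i; rewrite hn; have [->|Si] := eqVneq (S i) 0.
    by rewrite invr0 expr0n mul0r ler01.
  by rewrite exprVn -ler_pdivlMl ?invr_gt0 ?exprn_even_gt0 // invrK mulr1.
- by move=> i v vV; rewrite dotZl dV // mulr0.
- move=> i; rewrite -/(S i) scalerA -rmorphM; have [Si|Si] := eqVneq (S i) 0.
    have -> : d i = 0.
      apply: nrm2_eq0; apply/eqP; rewrite eq_le nrm2_ge0 andbT.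
      by have := nd_le i; rewrite Si expr0n.
    rewrite scaler0 addr0.
    have /eqP : d i = 0.
      apply: nrm2_eq0; apply/eqP; rewrite eq_le nrm2_ge0 andbT.
      by have := nd_le i; rewrite Si expr0n.
    by rewrite subr_eq0 => /eqP.
  by rewrite mulfV // rmorph1 scale1r addrC subrK.
- move=> i iU; rewrite -/(S i) => Si; rewrite hn nd {1}/nrm2 (frame_dot fe) eqxx iU.
  rewrite -(rmorph1 (@of_real R k)) of_realK -S2 exprVn mulVf //.
  by rewrite expf_neq0.
Qed.

(** The trace inequality behind the triangle inequality.  Principal bases of
    [U] and [U'] give a unitary map [U' -> U] whose composition with the
    projection has trace [\sum_i c i]; computed in the principal bases relative
    to [V], the same trace is a sum of cosine-cosine and sine-sine products with
    doubly substochastic weights. *)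
Lemma trace_inequality V U U' s s' c e e' f f' a a' :
  \dim U = \dim U' ->
  principal U V s e f -> principal U' V s' e' f' -> principal U U' c a a' ->
  \sum_(i < \dim U) c i <=
  \sum_(i < \dim U) cos (acos (s i) - acos (s' i)).
Proof.
move=> dUU' H H' Hc; set r := \dim U.
have [fe ff s0 sd ef] := H; have [fe' ff' s0' sd' ef'] := H'.
have [fa fa' c0 cd ac] := Hc.
have [h [ho h1 hV hE _]] := cosine_sine H.
have [h' [ho' h1' hV' hE' _]] := cosine_sine H'.
pose S i := sin (acos (s i)); pose S' i := sin (acos (s' i)).
(* The image of [e' l] under the unitary map sending [a' i] to [a i]. *)
pose t l := \sum_(i < r) dot (e' l) (a' i) *: a i.
have tU l : t l \in U.
  by apply: rpred_sum => i _; apply: rpredZ; exact: (frame_mem fa).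
have ta l (i : 'I_r) : dot (t l) (a i) = dot (e' l) (a' i).
  rewrite dot_suml (bigD1 i) //= big1 => [|j ji].
    by rewrite dotZl (frame_dot fa) eqxx ltn_ord mulr1 addr0.
  by rewrite dotZl (frame_dot fa) val_eqE (negPf ji) mulr0.
have ft : frame U t.
  split=> // l l'; rewrite (parseval (t l') fa (tU l)).
  under eq_bigr do rewrite !ta.
  by rewrite -/r /r dUU' -(parseval (e' l') fa') ?(frame_mem fe') // (frame_dot fe').
have ee j l : dot (e j) (e' l) = of_real k (s j * s' l) * dot (f j) (f' l)
    + of_real k (S j * S' l) * dot (h j) (h' l).
  rewrite (hE j) (hE' l) dotDl !dotDr !dotZl !dotZr !sconj_real.
  rewrite (hV j) ?(frame_mem ff') // (dot_eq0C (hV' l (f j) (frame_mem ff j))).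
  by rewrite !rmorphM -/(S j) -/(S' l) /=; ring.
have tr : of_real k (\sum_(i < r) c i) = \sum_(l < r) dot (t l) (e' l).
  rewrite rmorph_sum /=; transitivity (\sum_(i < r) dot (a i) (a' i)).
    by apply: eq_bigr => i _; rewrite ac eqxx.
  under [RHS]eq_bigr do rewrite dot_suml.
  rewrite [RHS]exchange_big /=; apply: eq_bigr => i _.
  rewrite dotC (parseval (a i) fe' (frame_mem fa' i)) rmorph_sum /= -dUU'.
  apply: eq_bigr => l _; rewrite dotZl rmorphM /= sconjK [dot (a' i) _]dotC.
  by rewrite sconjK.
have {}tr : \sum_(i < r) c i = \sum_(l < r) \sum_(j < r)
    (s j * s' l * rpart (dot (t l) (e j) * dot (f j) (f' l))
     + S j * S' l * rpart (dot (t l) (e j) * dot (h j) (h' l))).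
  rewrite -[LHS](of_realK k) tr raddf_sum /=; apply: eq_bigr => l _.
  rewrite (parseval (e' l) fe (tU l)) raddf_sum /=; apply: eq_bigr => j _.
  rewrite -dotC ee mulrDr raddfD /=; congr (_ + _).
    by rewrite mulrCA rpart_realM.
  by rewrite mulrCA rpart_realM.
(* Row and column sums are at most 1 by Bessel's inequality. *)
pose m (z z' : nat -> vec) j l :=
  (sqn (dot (t l) (e j)) + sqn (dot (z j) (z' l))) / 2.
have m0 z z' j l : 0 <= m z z' j l by rewrite divr_ge0 // addr_ge0 ?sqn_ge0.
have sqnC x y : sqn (dot x y) = sqn (dot y x) by rewrite dotC sqn_conj.
have m_row (z z' : nat -> vec) j : nrm2 (z j) <= 1 ->
    (forall i j, i != j -> dot (z' i) (z' j) = 0) -> (forall i, nrm2 (z' i) <= 1) ->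
    \sum_(l < r) m z z' j l <= 1.
  move=> z1 zo' z1'; rewrite -mulr_suml big_split /=.
  have B := le_trans (bessel r (z j) zo' z1') z1.
  have A : \sum_(l < r) sqn (dot (t l) (e j)) <= 1.
    under eq_bigr do rewrite sqnC.
    exact: le_trans (frame_bessel r (e j) ft) (frame_nrm2_le1 fe j).
  lra.
have m_col (z z' : nat -> vec) l : nrm2 (z' l) <= 1 ->
    (forall i j, i != j -> dot (z i) (z j) = 0) -> (forall i, nrm2 (z i) <= 1) ->
    \sum_(j < r) m z z' j l <= 1.
  move=> z1' zo z1; rewrite -mulr_suml big_split /=.
  have A := le_trans (frame_bessel r (t l) fe) (frame_nrm2_le1 ft l).
  have B : \sum_(j < r) sqn (dot (z j) (z' l)) <= 1.
    under eq_bigr do rewrite sqnC.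
    exact: le_trans (bessel r (z' l) zo z1) z1'.
  lra.
have S0 i : 0 <= S i by exact: sin_principal_ge0 H.
have S0' i : 0 <= S' i by exact: sin_principal_ge0 H'.
have Smono (X Y : Gr R k n) z b b' : principal X Y z b b' ->
    forall i j, (i <= j)%N -> sin (acos (z i)) <= sin (acos (z j)).
  move=> HX i j ij; have := acos_sorted HX ij.
  have := acos_principal i HX; have := acos_principal j HX.
  move=> /andP[j0 j1] /andP[i0 i1] leij.
  have [->//|neq] := eqVneq (acos (z i)) (acos (z j)).
  apply: ltW; rewrite ltr_sin ?lt_neqAle ?neq // in_itv /=; lra.
have cosE i : cos (acos (s i) - acos (s' i)) = s i * s' i + S i * S' i.
  by rewrite cosB (cos_principal _ H) (cos_principal _ H').
under [leRHS]eq_bigr do rewrite cosE.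
rewrite big_split /= tr exchange_big /=.
apply: le_trans (lerD
  (@rearrangement R s s' r (m f f') sd sd' s0 s0' (m0 _ _) _ _)
  (@rearrangement_nondecreasing R S S' r (m h h') (Smono _ _ _ _ _ H)
     (Smono _ _ _ _ _ H') S0 S0' (m0 _ _) _ _)).
- rewrite -big_split /=; apply: ler_sum => j _.
  rewrite -big_split /=; apply: ler_sum => l _.
  by apply: lerD; rewrite [leRHS]mulrC ler_wpM2l ?mulr_ge0 //; exact: rpartM_le.
- move=> j; apply: m_row; first exact: frame_nrm2_le1 ff j.
    exact: frame_ortho ff'.
  exact: frame_nrm2_le1 ff'.
- move=> l; apply: m_col; first exact: frame_nrm2_le1 ff' l.
    exact: frame_ortho ff.
  exact: frame_nrm2_le1 ff.
- by move=> j; apply: m_row.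
- by move=> l; apply: m_col.
Qed.

(** The trace inequality bounds the chords of the angle differences
    [x i = acos (s' i) - acos (s i)] by those of the angles between [U] and [U'];
    passing from chords to arcs costs a factor [1 - D ^+ 2 / 4], and Minkowski's
    inequality concludes. *)
Lemma dg_local V U U' : \dim U = \dim U' -> (\dim V <= \dim U)%N ->
  0 <= 1 - dg U U' ^+ 2 / 4 ->
  (1 - dg U U' ^+ 2 / 4) * dg V U' <=
  (1 - dg U U' ^+ 2 / 4) * dg V U + dg U U'.
Proof.
move=> dU VU; set D := dg U U'; set q := 1 - _ => q0.
have [s [e [f H]]] := principal_exists U V.
have [s' [e' [f' H']]] := principal_exists U' V.
have [c [a [a' Hc]]] := principal_exists U U'.
have UU' : (\dim U <= \dim U')%N by rewrite dU.
have D2 : D ^+ 2 = \sum_(i < \dim U) acos (c i) ^+ 2.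
  rewrite /D (dgE Hc UU') sqr_sqrtr //.
  by apply: sumr_ge0 => i _; exact: sqr_ge0.
pose x i := acos (s' i) - acos (s i).
have cs : \sum_(i < \dim U) 2 * (1 - cos (x i)) <= D ^+ 2.
  apply: (@le_trans _ _ (\sum_(i < \dim U) 2 * (1 - c i))); last first.
    rewrite D2; apply: ler_sum => i _; rewrite -[X in 1 - X](cos_principal i Hc).
    exact: chord_le_arc.
  rewrite -!mulr_sumr ler_pM2l // !sumrB lerD2l lerN2.
  apply: le_trans (trace_inequality dU H H' Hc) _.
  by apply: ler_sum => i _; rewrite -cosN opprB.
have cos0 i : 0 <= 2 * (1 - cos (x i)).
  by rewrite mulr_ge0 // subr_ge0 cos_le1.
have xarc (i : 'I_(\dim U)) : q ^+ 2 * x i ^+ 2 <= 2 * (1 - cos (x i)).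
  apply: arc_le_chord => //.
    have := acos_principal i H; have := acos_principal i H'.
    by rewrite /x => /andP[? ?] /andP[? ?]; rewrite ler_norml; lra.
  apply: le_trans cs; rewrite (bigD1 i) //= lerDl.
  by apply: sumr_ge0 => j _; exact: cos0.
rewrite (dgE (principal_sym H) VU) (dgE (principal_sym H')) -?dU //.
apply: le_trans (_ : q * (Num.sqrt (\sum_(i < \dim V) acos (s i) ^+ 2) +
   Num.sqrt (\sum_(i < \dim V) x i ^+ 2)) <= _); last first.
  rewrite mulrDr lerD2l.
  have -> : q = Num.sqrt (q ^+ 2) by rewrite sqrtr_sqr ger0_norm.
  rewrite -sqrtrM ?sqr_ge0 // -[leRHS]ger0_norm ?dg_ge0 // -sqrtr_sqr.
  apply: ler_wsqrtr; apply: le_trans cs.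
  rewrite mulr_sumr -(subnKC VU) big_split_ord /= -[leLHS]addr0.
  apply: lerD; last by apply: sumr_ge0 => i _; exact: cos0.
  apply: ler_sum => i _.
  exact: (xarc (widen_ord VU i)).
rewrite ler_wpM2l //; apply: le_trans _ (l2_triangle (fun i => acos (s i)) x _).
by apply: ler_wsqrtr; apply: ler_sum => i _; rewrite /x addrC subrK.
Qed.

(** Each principal vector of [U] is rotated at constant speed towards the
    corresponding one of [W], so that the principal angles between two positions
    are proportional to those between [U] and [W]. *)
Lemma geodesic_exists U W : (\dim U <= \dim W)%N -> exists gamma : R -> Gr R k n,
  [/\ gamma 0 = U, (gamma 1 <= W)%VS,
      forall t, \dim (gamma t) = \dim U
    & forall t u : R, 0 <= t <= 1 -> 0 <= u <= 1 ->
        dg (gamma t) (gamma u) = `|t - u| * dg U W].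
Proof.
move=> UW; have [s [a [b H]]] := principal_exists U W.
have [fa fb s0 sd ab] := H; have Hs := principal_sym H.
have [h [ho h1 hU hE hn]] := cosine_sine Hs.
set r := \dim U; pose th i := acos (s i).
pose v t i : vec := if (i < r)%N then
  of_real k (cos (t * th i)) *: a i + of_real k (sin (t * th i)) *: h i else 0.
(* [h i] is a unit vector unless the angle [th i], hence both sines, vanish. *)
have hlen i (t u : R) : (i < r)%N ->
    sin (t * th i) * sin (u * th i) * nrm2 (h i) = sin (t * th i) * sin (u * th i).
  move=> ir; have [S0|S0] := eqVneq (sin (th i)) 0; last first.
    by rewrite hn ?mulr1 // (leq_trans ir).
  have -> : th i = 0; last by rewrite mulr0 sin0 !mul0r.
  have := acos_principal i H; rewrite -/(th i) => /andP[t0 t1].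
  apply/eqP; rewrite eq_le t0 andbT leNgt; apply/negP => tp.
  have : 0 < sin (th i).
    by apply: sin_gt0_pi; rewrite tp (le_lt_trans t1) //; have := @pi_gt0 R; lra.
  by rewrite S0 ltxx.
have dv i j (t u : R) : dot (v t i) (v u j) =
    of_real k (if (i < r)%N then cos ((t - u) * th i) else 0) *+ (i == j).
  rewrite /v; case: (ltnP i r) => ir; last by rewrite dot0l rmorph0 mul0rn.
  case: (ltnP j r) => jr; last first.
    by rewrite dot0r; case: eqP => // ij; rewrite ij ltnNge jr in ir.
  rewrite dotDl !dotDr !dotZl !dotZr !sconj_real.
  rewrite (hU i) ?(frame_mem fa) // (dot_eq0C (hU j (a i) (frame_mem fa i))).
  rewrite (frame_dot fa) -/r ir; case: (eqVneq i j) => [<-|ij]; last first.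
    by rewrite ho // !mulr0 !addr0.
  rewrite -nrm2E !mulr1 !mulr0 addr0 add0r -!rmorphM -rmorphD /=.
  by rewrite mulrA hlen // mulrBl cosB.
have vd t i j : dot (v t i) (v t j) = ((i == j) && (i < r)%N)%:R.
  rewrite dv subrr mul0r cos0; case: ifP => _; first by rewrite rmorph1 andbT.
  by rewrite rmorph0 mul0rn andbF.
pose gamma t := spanned r (v t).
have dim t : \dim (gamma t) = r by have [] := frame_spanned (vd t).
have fr t : frame (gamma t) (v t) by have [] := frame_spanned (vd t).
exists gamma; split.
- apply/eqP; rewrite eqEdim dim leqnn andbT; apply/span_subvP => x /mapP[i _ ->].
  rewrite /v; case: ifP => _; last exact: mem0v.
  by rewrite mul0r cos0 sin0 rmorph1 rmorph0 scale1r scale0r addr0 (frame_mem fa).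
- apply/span_subvP => x /mapP[i _ ->].
  rewrite /v; case: ifP => _; last exact: mem0v.
  by rewrite !mul1r (cos_principal _ H) -hE (frame_mem fb).
- exact: dim.
move=> t u tI uI.
pose z i := if (i < r)%N then cos (`|t - u| * th i) else 0.
have tu : 0 <= `|t - u| <= 1 by rewrite normr_ge0 /= ler_norml; lra.
have thI i : 0 <= `|t - u| * th i <= pi / 2.
  have /andP[t0 t1] := acos_principal i H; case/andP: tu => tu0 tu1.
  by rewrite mulr_ge0 //= (le_trans _ t1) // ler_piMl.
have pp := @pi_gt0 R.
have thpi i : `|t - u| * th i \in `[0, pi].
  by rewrite in_itv /=; have := thI i; lra.
have Hz : principal (gamma t) (gamma u) z (v t) (v u).
  split=> //.
  - move=> i; rewrite /z; case: ifP => // _; apply: cos_ge0_pihalf.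
    by have := thI i; lra.
  - move=> i j ij; rewrite /z; case: (ltnP j r) => jr; last first.
      by case: ifP => // _; apply: cos_ge0_pihalf; have := thI i; lra.
    rewrite (leq_ltn_trans ij jr).
    have le : `|t - u| * th i <= `|t - u| * th j.
      by rewrite ler_wpM2l // (acos_sorted H).
    have [->//|ne] := eqVneq (`|t - u| * th i) (`|t - u| * th j).
    by apply: ltW; rewrite ltr_cos // lt_neqAle ne.
  - move=> i j; rewrite dv /z -[in RHS](cos_norm (_ * _)).
    rewrite normrM normr_id -normrM cos_norm //.
rewrite (dgE Hz) ?dim // (dgE H UW) -[ `|t - u|]ger0_norm ?normr_ge0 //.
rewrite -sqrtr_sqr -sqrtrM ?sqr_ge0 // mulr_sumr.
congr Num.sqrt; apply: eq_bigr => i _.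
by rewrite /z ltn_ord cosK // exprMn.
Qed.

(** Cutting the geodesic from [U] to [W] into many short pieces makes the
    corrections of [dg_local] disappear. *)
Lemma dg_triangle_le V U W : (\dim V <= \dim U)%N -> (\dim U <= \dim W)%N ->
  dg V W <= dg V U + dg U W.
Proof.
move=> VU UW; have [gamma [g0 g1 gdim gd]] := geodesic_exists UW.
apply: le_trans (dg_sub V g1) _; set D := dg U W.
have D0 : 0 <= D by exact: dg_ge0.
have step N : (0 < N)%N -> 0 <= 1 - (D / N%:R) ^+ 2 / 4 ->
    (1 - (D / N%:R) ^+ 2 / 4) * dg V (gamma 1) <=
    (1 - (D / N%:R) ^+ 2 / 4) * dg V U + D.
  move=> N0 c0; set c := 1 - _ in c0 *.
  have NR : 0 < N%:R :> R by rewrite ltr0n.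
  have ind i : (i <= N)%N ->
      c * dg V (gamma (i%:R / N%:R)) <= c * dg V U + i%:R * (D / N%:R).
    elim: i => [|i IH] iN; first by rewrite !mul0r addr0 g0.
    apply: le_trans (_ : _ <= c * dg V (gamma (i%:R / N%:R)) + D / N%:R) _; last first.
      have -> : i.+1%:R * (D / N%:R) = i%:R * (D / N%:R) + D / N%:R.
        by rewrite -[i.+1%:R]natr1 mulrDl mul1r.
      by rewrite [leRHS]addrA lerD2r; exact: IH (ltnW iN).
    have I01 j : (j <= N)%N -> 0 <= (j%:R / N%:R : R) <= 1.
      by move=> jN; rewrite divr_ge0 //= ler_pdivrMr // mul1r ler_nat.
    have dE : dg (gamma (i%:R / N%:R)) (gamma (i.+1%:R / N%:R)) = D / N%:R.
      rewrite gd; [|exact: I01 (ltnW iN)|exact: I01 iN].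
      rewrite -mulrBl -[i.+1%:R]natr1 opprD addrA subrr sub0r mulN1r normrN ger0_norm.
        by rewrite mulrC.
      by rewrite invr_ge0 ltW.
    have := @dg_local V (gamma (i%:R / N%:R)) (gamma (i.+1%:R / N%:R)).
    by rewrite dE !gdim; apply.
  by have := ind N (leqnn _); rewrite divff ?gt_eqF // mulrCA divff ?gt_eqF // mulr1.
rewrite leNgt; apply/negP => lt.
set X := dg V (gamma 1) in lt step; set Y := dg V U in lt step.
have gap : 0 < X - Y - D by lra.
(* The [N] corrections add up to at most [D ^+ 2 * (X - Y) / (4 * N)], which is
   less than [gap] as soon as [N > K]; the term [D ^+ 2] in [K] keeps the factor
   [1 - (D / N) ^+ 2 / 4] nonnegative. *)
have XY : 0 < X - Y by lra.
pose K := D ^+ 2 * (X - Y) / (4 * (X - Y - D)) + D ^+ 2.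
have K1 : 0 <= D ^+ 2 * (X - Y) / (4 * (X - Y - D)).
  by rewrite divr_ge0 ?mulr_ge0 ?sqr_ge0 // ltW.
have KN : K < (Num.bound K).+1%:R.
  rewrite (lt_trans (archi_boundP _)) ?ltr_nat //.
  by rewrite addr_ge0 ?sqr_ge0.
set N := (Num.bound K).+1 in KN; have N1 : 1 <= N%:R :> R by rewrite ler1n.
have NR : 0 < N%:R :> R by rewrite ltr0n.
pose e := (D / N%:R) ^+ 2.
have e0 : 0 <= e by exact: sqr_ge0.
have eN : e * N%:R <= D ^+ 2.
  rewrite (_ : e * N%:R = D ^+ 2 / N%:R); last by rewrite /e; field; rewrite gt_eqF.
  by rewrite ler_pdivrMr // ler_peMr // sqr_ge0.
have e1 : e <= 1.
  rewrite -(ler_pM2r NR) mul1r (le_trans eN) // ltW //; apply: le_lt_trans KN.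
  by rewrite /K lerDr.
have := step N isT; rewrite -/e => /(_ _) H.
have {}H : X - Y - D <= e / 4 * (X - Y).
  by have := H ltac:(lra); lra.
have : (X - Y - D) * N%:R <= D ^+ 2 / 4 * (X - Y).
  apply: le_trans (_ : _ <= e / 4 * (X - Y) * N%:R) _; first by rewrite ler_pM2r.
  rewrite [leLHS](_ : _ = e * N%:R * ((X - Y) / 4)); last by ring.
  rewrite [leRHS](_ : _ = D ^+ 2 * ((X - Y) / 4)); last by ring.
  by rewrite ler_wpM2r // divr_ge0 // ltW.
apply/negP; rewrite -ltNge; apply: le_lt_trans (_ : _ <= (X - Y - D) * K) _.
  have -> : D ^+ 2 / 4 * (X - Y) =
      (X - Y - D) * (D ^+ 2 * (X - Y) / (4 * (X - Y - D))).
    by field; rewrite gt_eqF.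
  by rewrite /K [leRHS]mulrDr lerDl mulr_ge0 ?sqr_ge0 // ltW.
by rewrite ltr_pM2l.
Qed.

(** In the other dimension orders one of the two terms on the right is [Delta] of
    a dimension at least [\dim V], hence an upper bound of [dg V W]. *)
Lemma dg_triangle V U W : dg V W <= dg V U + dg U W.
Proof.
have [VU|UV] := leqP (\dim V) (\dim U); last first.
  by rewrite (dg_gtdim UV) (le_trans (dg_le_Delta V W)) // lerDl dg_ge0.
have [UW|WU] := leqP (\dim U) (\dim W); first exact: dg_triangle_le.
rewrite (dg_gtdim WU) (le_trans (dg_le_Delta V W)) //.
by rewrite (le_trans (_ : _ <= Delta R (\dim U))) ?Delta_le // lerDr dg_ge0.
Qed.

End Triangle.

(* Distances are hidden before calling [lra], which would otherwise compare them
   by unfolding: hypotheses about them have to be premises of the goal. *)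
Ltac dglra :=
  repeat match goal with H : context [dg _ _] |- _ => clear H end;
  repeat match goal with |- context [dg ?A ?B] => generalize (dg A B); intro end;
  lra.

(** * Continuity and length of curves *)

Section Curves.
Variables (R : realType) (k : scalars) (n : nat) (s : side).
Implicit Types (U V W X Y Z : Gr R k n) (gamma mu eta : R -> Gr R k n).
Implicit Types (a b c d r t u : R) (I : set R) (phi : R -> R).

(** The distance whose balls around [X] generate the topology of side [s]. *)
Definition sdist X Y : R := match s with Minus => dg Y X | Plus => dg X Y end.

Lemma gr_ballE X r Y : gr_ball s X r Y = (sdist X Y < r).
Proof. by rewrite /gr_ball /sdist; case: s. Qed.

Lemma sdist_triangle X Y Z : sdist X Z <= sdist X Y + sdist Y Z.
Proof. by rewrite /sdist; case: s; [rewrite [leRHS]addrC|]; exact: dg_triangle. Qed.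

Lemma sdistxx X : sdist X X = 0.
Proof. by rewrite /sdist; case: s; exact: dgxx. Qed.

(** All balls together are only a subbase of the topology, but by the triangle
    inequality every ball containing [X] contains a ball centred at [X]. *)
Lemma gr_nbhsP (X : Gr_top R k n s) (A : set (Gr_top R k n s)) :
  nbhs X A <-> exists2 r, 0 < r & forall Y : Gr R k n, sdist X Y < r -> A Y.
Proof.
split=> [|[r r0 rA]]; last first.
  apply: (@filterS _ (nbhs X) _ (gr_ball s X r : set (Gr_top R k n s))).
    by move=> Y; rewrite gr_ballE; exact: rA.
  exists (gr_ball s X r); split; last by [].
    exists [set (gr_ball s X r : set (Gr_top R k n s))]; last by rewrite bigcup_set1.
    move=> _ ->; exists [fset ((X : Gr_top R k n s), r)]%fset.
      by move=> i; rewrite in_fset1 => /eqP ->; apply: mem_set.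
    by rewrite set_fset1 bigcap_set1.
  by rewrite /= gr_ballE sdistxx.
move=> [B [[/= J Jfin <-]]] [C /[dup] /Jfin [D Dpos <-] JD XD] JA.
have [r r0 rD] : exists2 r, 0 < r & forall i, i \in enum_fset D ->
    forall Y : Gr R k n, sdist X Y < r -> gr_ball s (i.1 : Gr R k n) i.2 Y.
  have : forall i, i \in enum_fset D -> 0 < i.2 /\ sdist i.1 X < i.2.
    move=> i iD; split; first by have /set_mem := Dpos i iD.
    by rewrite -gr_ballE; exact: XD.
  move: (enum_fset D) => l; elim: l => [|i l IH] h; first by exists 1.
  have [|r r0 rl] := IH; first by move=> j jl; apply: h; rewrite inE jl orbT.
  have [i0 iX] := h i (mem_head _ _).
  exists (Num.min r (i.2 - sdist i.1 X)); first by rewrite lt_min r0 subr_gt0.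
  move=> j; rewrite inE => /orP[/eqP ->|jl] Y; rewrite lt_min => /andP[Yr Yi].
    by rewrite gr_ballE (le_lt_trans (sdist_triangle _ X _)) // addrC -ltrBrDr.
  exact: rl.
exists r => // Y XY; apply: JA; exists (\bigcap_(i in [set` D]) gr_ball s (i.1 : Gr R k n) i.2) => //.
by move=> i /= iD; exact: rD.
Qed.

Lemma curveP I gamma : curve s I gamma <->
  forall t, I t -> forall e, 0 < e -> exists2 del, 0 < del &
    forall u, I u -> `|u - t| < del -> sdist (gamma t) (gamma u) < e.
Proof.
rewrite /curve; split=> [/subspace_continuousP cg t It e e0|h].
  have /gr_nbhsP : exists2 r : R, 0 < r & forall Y : Gr R k n,
      sdist (gamma t) Y < r -> [set Z : Gr_top R k n s | sdist (gamma t) Z < e] Y.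
    by exists e.
  move=> /(cg t It); rewrite /within /= => /nbhs_ballP[del del0 hdel].
  by exists del => // u Iu ut; apply: hdel => //; rewrite /ball /= distrC.
apply/subspace_continuousP => t It A /gr_nbhsP[e e0 eA].
have [del del0 hdel] := h t It e e0.
apply/nbhs_ballP; exists del => // u; rewrite /ball /= distrC => ut Iu.
by apply: eA; exact: hdel.
Qed.

Lemma polygonal_cons gamma t u l :
  polygonal_length gamma [:: t, u & l] =
  dg (gamma t) (gamma u) + polygonal_length gamma (u :: l).
Proof. by rewrite /polygonal_length /= big_ord_recl. Qed.

Lemma polygonal1 gamma t : polygonal_length gamma [:: t] = 0.
Proof. by rewrite /polygonal_length big_ord0. Qed.

(** Repeated points can be deleted from a subdivision, since [dg V V = 0]. *)
Lemma polygonal_le_length I gamma (l : seq R) :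
  sorted <=%R l -> {in l, forall t, I t} ->
  ((polygonal_length gamma l)%:E <= curve_length I gamma)%E.
Proof.
case: l => [_ _|x l sl lI].
  by apply: ereal_sup_ubound; exists [::].
have [l' [sl' ll' ->]] : exists l', [/\ path <%R x l', {subset l' <= l}
    & polygonal_length gamma (x :: l) = polygonal_length gamma (x :: l')].
  elim: l x sl {lI} => [|y l IH] x /=; first by exists [::].
  move=> /andP[xy /IH [l' [sl' ll' E]]].
  have [xE|neq] := eqVneq x y.
    exists l'; rewrite xE; split=> // [z /ll'|]; first by rewrite inE orbC => ->.
    by rewrite polygonal_cons dgxx add0r.
  exists (y :: l'); split; first by rewrite /= lt_neqAle neq xy.
    by move=> z; rewrite !inE => /orP[->//|/ll' ->]; rewrite orbT.
  by rewrite !polygonal_cons E.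
apply: ereal_sup_ubound; exists (x :: l') => //; split=> // t.
rewrite inE => /orP[/eqP ->|/ll' tl]; apply: lI; first exact: mem_head.
by rewrite inE tl orbT.
Qed.

Lemma dg_le_length I gamma t u : t <= u -> I t -> I u ->
  ((dg (gamma t) (gamma u))%:E <= curve_length I gamma)%E.
Proof.
move=> tu It Iu; have := @polygonal_le_length I gamma [:: t; u].
rewrite polygonal_cons polygonal1 addr0 /= andbT; apply=> //.
by move=> x; rewrite !inE => /orP[] /eqP ->.
Qed.

Lemma polygonal_le_potential I gamma phi (l : seq R) (L : R) :
  (forall t u, I t -> I u -> t <= u -> dg (gamma t) (gamma u) <= phi u - phi t) ->
  (forall t u, I t -> I u -> t <= u -> phi u - phi t <= L) -> 0 <= L ->
  sorted <%R l -> {in l, forall t, I t} -> polygonal_length gamma l <= L.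
Proof.
move=> hphi hL L0; case: l => [|x l] sl lI.
  by rewrite /polygonal_length big_ord0.
suff H : polygonal_length gamma (x :: l) <= phi (last x l) - phi x
    /\ x <= last x l.
  by have [H1 H2] := H; apply: le_trans H1 (hL _ _ _ _ H2); apply: lI;
    [exact: mem_head|exact: mem_last].
elim: l x sl lI => [|y l IH] x; first by rewrite polygonal1 subrr.
move=> /= /andP[xy sl] lI.
have [|H1 H2] := IH y sl; first by move=> t tl; apply: lI; rewrite inE tl orbT.
have xI : I x by apply: lI; exact: mem_head.
have yI : I y by apply: lI; rewrite !inE eqxx orbT.
have := hphi x y xI yI (ltW xy); rewrite polygonal_cons.
by split; [lra|rewrite (le_trans (ltW xy))].
Qed.

Lemma curve_length_le I gamma phi (L : R) :
  (forall t u, I t -> I u -> t <= u -> dg (gamma t) (gamma u) <= phi u - phi t) ->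
  (forall t u, I t -> I u -> t <= u -> phi u - phi t <= L) -> 0 <= L ->
  (curve_length I gamma <= L%:E)%E.
Proof.
move=> hphi hL L0; apply: ge_ereal_sup => _ [l [sl lI] <-].
by rewrite lee_fin; exact: polygonal_le_potential hphi hL L0 sl lI.
Qed.

Lemma null_curve_sub I gamma t u : null_curve I gamma -> t <= u -> I t -> I u ->
  (gamma t <= gamma u)%VS.
Proof.
move=> L0 tu It Iu; apply/dg_eq0P/eqP; rewrite eq_le dg_ge0 andbT.
by have := dg_le_length gamma tu It Iu; rewrite L0 lee_fin.
Qed.

(** * Segments *)

(** Polygonal lengths telescope against [phi].  Segments are always constructed
    through such a potential, so that subdivisions appear only once. *)
Lemma segment_of_potential V W a b gamma phi : is_path s V W a b gamma ->
  (forall t u, a <= t -> t <= u -> u <= b ->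
     dg (gamma t) (gamma u) <= phi u - phi t) ->
  phi b - phi a <= dg V W -> segment s V W a b gamma.
Proof.
move=> pg hphi hab; split=> //; have [ab _ ga gb _] := pg.
apply/eqP; rewrite eq_le; apply/andP; split.
  apply: (curve_length_le (phi := phi)); last exact: dg_ge0.
    by move=> t u /= /andP[]/=; rewrite !bnd_simp => ? ? /andP[]; rewrite !bnd_simp => ? ? ?; apply: hphi.
  move=> t u /= /andP[]/=; rewrite !bnd_simp => at_ tb /andP[]; rewrite !bnd_simp => au ub tu.
  have h1 := hphi a t (lexx _) at_ tb; have h2 := hphi u b au ub (lexx _).
  move: hab h1 h2; have := dg_ge0 (gamma a) (gamma t); have := dg_ge0 (gamma u) (gamma b); dglra.
rewrite -ga -gb; apply: dg_le_length => //=; rewrite in_itv /= ?lexx ?ab //.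
Qed.

(** Conversely the distance to the starting point is a potential: compare the
    length of the polygon [V, gamma t, gamma u, W] with the triangle inequality. *)
Lemma potential_of_length V W a b gamma : is_path s V W a b gamma ->
  (curve_length `[a, b] gamma <= (dg V W)%:E)%E ->
  forall t u, a <= t -> t <= u -> u <= b ->
    dg (gamma t) (gamma u) <= dg V (gamma u) - dg V (gamma t).
Proof.
move=> [ab _ ga gb _] L t u at_ tu ub.
have := @polygonal_le_length `[a, b]%classic gamma [:: a; t; u; b].
rewrite !polygonal_cons polygonal1 ga gb /= at_ tu ub => /(_ isT) H.
have : ((dg V (gamma t) + (dg (gamma t) (gamma u) + (dg (gamma u) W + 0)))%:E
    <= (dg V W)%:E)%E.
  apply: le_trans L; apply: H => x; rewrite !inE.
  move=> /or4P[] /eqP -> /=; rewrite in_itv /= ?lexx ?ab ?at_ ?ub ?andbT //=.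
    exact: le_trans tu ub.
  exact: le_trans at_ tu.
rewrite lee_fin.
have := dg_triangle V (gamma u) W.
dglra.
Qed.

(** The potentials of the two segments are glued at [U]; across [U] the distances
    are controlled by the triangle inequality. *)
Lemma segment_concat V U W a b c d gamma1 gamma2 :
  segment s V U a b gamma1 -> segment s U W c d gamma2 ->
  dg V W = dg V U + dg U W ->
  exists e gamma, segment s V W a e gamma /\ exists2 t, t \in `[a, e] & U = gamma t.
Proof.
move=> [p1 L1] [p2 L2] dVW.
have [ab cg1 g1a g1b _] := p1; have [cd cg2 g2c g2d _] := p2.
have pot1 := potential_of_length p1; rewrite L1 lexx in pot1.
have pot2 := potential_of_length p2; rewrite L2 lexx in pot2.
have {}pot1 := pot1 isT; have {}pot2 := pot2 isT.
pose q t := t - b + c.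
pose gamma t := if t <= b then gamma1 t else gamma2 (q t).
pose e := b + (d - c).
have be : b <= e by rewrite /e; dglra.
have qb : q b = c by rewrite /q subrr add0r.
have gb : gamma b = U by rewrite /gamma lexx.
have gr t : b <= t -> gamma t = gamma2 (q t).
  rewrite le_eqVlt => /orP[/eqP <-|bt]; last by rewrite /gamma leNgt bt.
  by rewrite gb qb g2c.
have gl t : t <= b -> gamma t = gamma1 t by rewrite /gamma => ->.
exists e, gamma; split; last by exists b; rewrite ?gb // in_itv /= ab be.
pose phi t := if t <= b then dg V (gamma1 t) else dg V U + dg U (gamma2 (q t)).
have pb : phi b = dg V U by rewrite /phi lexx g1b.
have pr t : b <= t -> phi t = dg V U + dg U (gamma2 (q t)).
  rewrite le_eqVlt => /orP[/eqP <-|]; last first.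
    by rewrite ltNge /phi => /negPf ->; exact: erefl.
  by rewrite pb qb g2c dgxx addr0.
apply: (segment_of_potential (phi := phi)).
- split=> //; first exact: le_trans be.
  + move/curveP: cg1 => cg1; move/curveP: cg2 => cg2.
    apply/curveP => t /=; rewrite in_itv /= => /andP[at_ te] eps eps0.
    have [tb|bt] := ltP t b.
      have [|del del0 h] := cg1 t _ eps eps0; first by rewrite /= in_itv /= at_ ltW.
      exists (Num.min del (b - t)); first by rewrite lt_min del0 subr_gt0.
      move=> u /=; rewrite in_itv /= => /andP[au ue]; rewrite lt_min => /andP[ut ub].
      have {}ub : u <= b by move: ub; rewrite ltr_norml; dglra.
      by rewrite (gl t (ltW tb)) (gl u ub) h //= in_itv /= au.
    have qt : c <= q t <= d by rewrite /q; move: te; rewrite /e; dglra.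
    have [|del2 del20 h2] := cg2 (q t) _ eps eps0; first by rewrite /= in_itv.
    have [t_b|tb] := eqVneq t b.
      have [|del1 del10 h1] := cg1 t _ eps eps0; first by rewrite /= in_itv /= at_ t_b lexx.
      exists (Num.min del1 del2); first by rewrite lt_min del10.
      move=> u /=; rewrite in_itv /= => /andP[au ue]; rewrite lt_min => /andP[ut1 ut2].
      have [ub|bu] := leP u b.
        by rewrite gl ?t_b // gl // -t_b h1 //= in_itv /= au ub.
      rewrite (gr t bt) (gr u (ltW bu)); apply: h2 => /=.
        by rewrite in_itv /= /q; move: ue; rewrite /e; dglra.
      by rewrite /q (_ : u - b + c - _ = u - t) //; ring.
    have {tb}bt' : b < t by rewrite lt_neqAle eq_sym tb.
    exists (Num.min del2 (t - b)); first by rewrite lt_min del20 subr_gt0.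
    move=> u /=; rewrite in_itv /= => /andP[au ue]; rewrite lt_min => /andP[ut ub].
    have {}ub : b <= u by move: ub; rewrite ltr_norml; dglra.
    rewrite (gr t bt) (gr u ub); apply: h2 => /=.
      by rewrite in_itv /= /q; move: ue; rewrite /e; dglra.
    by rewrite /q (_ : u - b + c - _ = u - t) //; ring.
  + by rewrite gl.
  + by rewrite gr // -g2d; congr gamma2; rewrite /q /e; ring.
- move=> t u at_ tu ue; have [ub|bu] := leP u b.
    have tb := le_trans tu ub; rewrite (gl t tb) (gl u ub) /phi tb ub.
    exact: pot1.
  have qu : c <= q u <= d by rewrite /q; move: ue; rewrite /e; dglra.
  have [tb|bt] := leP t b.
    rewrite (gl t tb) (gr u (ltW bu)) (pr u (ltW bu)) {1}/phi tb.
    have := pot1 t b at_ tb (lexx _); rewrite g1b.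
    have := dg_triangle (gamma1 t) U (gamma2 (q u)); dglra.
  have bt' := ltW bt; rewrite (gr t bt') (gr u (ltW bu)) (pr t bt') (pr u (ltW bu)).
  have := pot2 (q t) (q u); rewrite /q; case/andP: qu => _ qd.
  by move=> /(_ _ _ _) H; have {H} := H ltac:(dglra) ltac:(dglra) qd; dglra.
- rewrite (pr e be) /phi ab g1a dgxx dVW (_ : q e = d) ?g2d; first by dglra.
  by rewrite /q /e; ring.
Qed.

(** A path with a single jump is continuous if the distance [sdist] from the value
    at the jump to the other value vanishes, which can be arranged by placing the
    jump at the right one of the two endpoints. *)
Lemma jump_segment V W : (V <= W)%VS \/ (W <= V)%VS ->
  exists gamma, segment s V W 0 1 gamma.
Proof.
move=> VW; have [sVW|sWV] : sdist V W = 0 \/ sdist W V = 0.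
- rewrite /sdist; case: s; case: VW => /dg_eq0P ->; by [left|right].
- pose gamma t := if t <= 0 then V else W.
  pose phi t := if t <= 0 then 0 else dg V W.
  exists gamma; apply: (segment_of_potential (phi := phi)).
  + split=> //; rewrite ?ler01 /gamma ?lexx ?ler10 //.
    apply/curveP => t /= tI e e0; have [t0|t0] := leP t 0.
      by exists 1 => // u _ _; case: ifP => _; rewrite ?sdistxx ?sVW.
    exists t => // u _ ut; rewrite leNgt (_ : 0 < u) ?sdistxx //.
    by move: ut; rewrite ltr_norml; dglra.
  + move=> t u t0 tu u1; rewrite /gamma /phi; case: (leP u 0) => u0.
      by rewrite (le_trans tu u0) dgxx subrr.
    by case: ifP => _; rewrite ?dgxx ?subr0 ?subrr.
  + by rewrite /phi lexx ler10 subr0.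
pose gamma t := if t < 1 then V else W.
pose phi t := if t < 1 then 0 else dg V W.
exists gamma; apply: (segment_of_potential (phi := phi)).
- split=> //; rewrite ?ler01 /gamma ?ltr01 ?ltxx //.
  apply/curveP => t /= tI e e0; have [t1|t1] := ltP t 1; last first.
    by exists 1 => // u _ _; case: ifP => _; rewrite ?sdistxx ?sWV.
  exists (1 - t); first by rewrite subr_gt0.
  move=> u _ ut; rewrite (_ : u < 1) ?sdistxx //.
  by move: ut; rewrite ltr_norml; dglra.
- move=> t u t0 tu u1; rewrite /gamma /phi; case: (ltP u 1) => u0.
    by rewrite (le_lt_trans tu u0) dgxx subrr.
  by case: ifP => _; rewrite ?dgxx ?subr0 ?subrr.
- by rewrite /phi ltr01 ltxx subr0.
Qed.

Lemma sdist_sym_le X Y c : dg X Y <= c -> dg Y X <= c -> sdist X Y <= c.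
Proof. by rewrite /sdist; case: s. Qed.

(** The geodesic of [geodesic_exists] is Lipschitz for [dg] in both directions,
    hence continuous for either side. *)
Lemma geodesic_segment V W : (\dim V <= \dim W)%N -> exists W' gamma,
  [/\ (W' <= W)%VS, segment s V W' 0 1 gamma, dg V W' = dg V W
    & forall t, \dim (gamma t) = \dim V].
Proof.
move=> VW; have [gamma [g0 g1 gdim gd]] := geodesic_exists VW.
exists (gamma 1), gamma; have D0 := dg_ge0 V W.
have dE : dg V (gamma 1) = dg V W.
  by rewrite -{1}g0 gd ?lexx ?ler01 // sub0r normrN1 mul1r.
split; [exact: g1| |exact: dE|exact: gdim].
move: (dg V W) dE D0 gd => D dE D0 gd.
apply: (segment_of_potential (phi := fun t => t * D)).
- split; [exact: ler01| |exact: g0|by []|by []].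
  apply/curveP => t /=; rewrite in_itv /= => tI e e0.
  exists (e / (D + 1)); first by rewrite divr_gt0 // ltr_wpDl.
  move=> u /=; rewrite in_itv /= => uI; rewrite ltr_pdivlMr ?ltr_wpDl // => ut.
  apply: le_lt_trans ut; apply: sdist_sym_le.
    by rewrite gd // distrC ler_wpM2l // lerDl.
  by rewrite gd // ler_wpM2l // lerDl.
- move=> t u t0 tu u1; rewrite gd ?t0 ?u1 ?(le_trans tu u1) ?(le_trans t0 tu) //.
  by rewrite distrC ger0_norm ?subr_ge0 // mulrBl.
- by rewrite dE; dglra.
Qed.

(** If [\dim V <= \dim W], a geodesic to a subspace of [W] followed by a jump into
    [W], which costs nothing; otherwise a jump to [0], of the maximal length
    [Delta R (\dim V)], followed by a free jump to [W]. *)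
Lemma segment_exists V W : exists a b gamma, segment s V W a b gamma.
Proof.
have [VW|WV] := leqP (\dim V) (\dim W).
  have [W' [g1 [W'W S1 dE _]]] := geodesic_segment VW.
  have [g2 S2] := jump_segment (or_introl W'W).
  have [|e [g [S _]]] := segment_concat S1 S2; last by exists 0, e, g.
  by move: dE (proj2 (dg_eq0P W' W) W'W); dglra.
have [g1 S1] := jump_segment (or_intror (sub0v V)).
have [g2 S2] := jump_segment (or_introl (sub0v W)).
have [|e [g [S _]]] := segment_concat S1 S2; last by exists 0, e, g.
have V0 : (\dim (0%VS : Gr R k n) < \dim V)%N by rewrite dimv0 (leq_ltn_trans _ WV).
by move: (dg_gtdim WV) (dg_gtdim V0) (proj2 (dg_eq0P 0%VS W) (sub0v W)); dglra.
Qed.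

Lemma segment_length_le V W a b gamma : is_path s V W a b gamma ->
  (curve_length `[a, b] gamma <= (dg V W)%:E)%E -> segment s V W a b gamma.
Proof.
move=> pg L; have [ab _ ga gb _] := pg.
apply: (segment_of_potential (phi := fun t => dg V (gamma t))) => //.
  exact: potential_of_length pg L.
by rewrite ga gb dgxx subr0.
Qed.

End Curves.

(** * Paths of type I *)

Section TypeI.
Variables (R : realType) (k : scalars) (n : nat) (s : side).
Implicit Types (U V W M E : Gr R k n) (gamma mu eta : R -> Gr R k n).
Implicit Types (a b t u : R).

Lemma frame_cat M E e c : perp M E -> frame M e -> frame E c ->
  \dim (E + M) = (\dim E + \dim M)%N /\
  frame (E + M)%VS (fun i => if (i < \dim E)%N then c i else e (i - \dim E)%N).
Proof.
move=> /perpP ME fM fE; have d : \dim (E + M) = (\dim E + \dim M)%N.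
  apply: dimv_disjoint_sum; apply/eqP; rewrite -subv0; apply/subvP => v.
  rewrite memv_cap => /andP[vE vM]; rewrite memv0; apply/eqP/dot_eq0.
  exact: ME.
split=> //; split=> [i|i j].
  case: ifP => _; first by rewrite (subvP (addvSl _ _)) // (frame_mem fE).
  by rewrite (subvP (addvSr _ _)) // (frame_mem fM).
have eo i' j' : dot (e i') (c j') = 0.
  by apply: ME; [exact: frame_mem fM _|exact: frame_mem fE _].
rewrite d; case: (ltnP i (\dim E)) => iE; case: (ltnP j (\dim E)) => jE.
- by rewrite (frame_dot fE) iE ltn_addr.
- by rewrite (dot_eq0C (eo _ _)); case: eqP => // ij; rewrite ij ltnNge jE in iE.
- by rewrite eo; case: eqP => // ij; rewrite ij leqNgt jE in iE.
- by rewrite (frame_dot fM); congr (_ && _)%:R; lia.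
Qed.

(** A common orthogonal summand only adds vanishing principal angles. *)
Lemma dg_add_common M M' E : \dim M = \dim M' -> perp M E -> perp M' E ->
  dg (M + E)%VS (M' + E)%VS = dg M M'.
Proof.
move=> dM ME M'E; rewrite addvC [(M' + E)%VS]addvC.
have [z [e [g H]]] := principal_exists M M'; have [fe fg z0 zd ez] := H.
have [c fc] := frame_exists E.
have [d1 f1] := frame_cat ME fe fc; have [d2 f2] := frame_cat M'E fg fc.
pose q := \dim E; pose z' i := if (i < q)%N then 1 else z (i - q)%N.
have z1 i : z i <= 1 by exact: principal_le1 H.
have eo i j : dot (e i) (c j) = 0.
  by move/perpP: ME; apply; [exact: frame_mem fe _|exact: frame_mem fc _].
have go i j : dot (c j) (g i) = 0.
  apply: dot_eq0C.
  by move/perpP: M'E; apply; [exact: frame_mem fg _|exact: frame_mem fc _].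
have H' : principal (E + M)%VS (E + M')%VS z'
    (fun i => if (i < q)%N then c i else e (i - q)%N)
    (fun i => if (i < q)%N then c i else g (i - q)%N).
  split=> //.
  - by move=> i; rewrite /z'; case: ifP.
  - move=> i j ij; rewrite /z'; case: (ltnP j q) => jq.
      by rewrite (leq_ltn_trans ij jq).
    by case: ifP => // _; apply: zd; rewrite leq_sub2r.
  - move=> i j; rewrite /z'; case: (ltnP i q) => iq; case: (ltnP j q) => jq.
    + by rewrite (frame_dot fc) -/q iq andbT rmorph1.
    + by rewrite go; case: eqP => // ij; rewrite ij ltnNge jq in iq.
    + by rewrite eo; case: eqP => // ij; rewrite ij leqNgt jq in iq.
    + by rewrite ez; congr (_ *+ nat_of_bool _); lia.
rewrite (dgE H') ?d1 ?d2 ?dM // (dgE H) ?dM //; congr Num.sqrt.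
rewrite big_split_ord /= big1 ?add0r => [|i _].
  by apply: eq_bigr => i _; rewrite /z' ltnNge leq_addr /= addKn.
by rewrite /z' ltn_ord acos1 expr0n.
Qed.

(** All lengths of paths from [V] to [W] are at least [dg V W], and a segment
    attains this bound. *)
Lemma minimal_geodesic_segment V W a b gamma :
  minimal_geodesic s V W a b gamma -> segment s V W a b gamma.
Proof.
move=> [pg L]; apply: segment_length_le => //; rewrite L.
have [a' [b' [g' [pg' L']]]] := segment_exists s V W.
by apply: ereal_inf_lbound; exists a', b', g'.
Qed.

(** The geodesic part travels the whole distance; adding the null part does not
    increase any of the distances along it. *)
Lemma type_I_segment V W a b gamma :
  type_I s V W a b gamma -> segment s V W a b gamma.
Proof.
move=> [pg [W' [mu [eta [PW' [pmu Lmu] peta neta sum]]]]].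
have [ab cmu mua mub muA] := pmu.
have dmu t : a <= t -> t <= b -> \dim (mu t) = \dim V.
  by move=> at_ tb; apply: muA; rewrite in_itv /= at_.
have dW' : \dim W' = \dim V by rewrite -mub dmu.
have VW : (\dim V <= \dim W)%N.
  by have [_ dE _] := PW'; move: dE; rewrite dW' => ->; exact: geq_minr.
have VW' : (\dim V <= \dim W')%N by rewrite dW'.
have Lmu' : (curve_length `[a, b] mu <= (dg V W')%:E)%E.
  have [X [g [XW' [pg' Lg] dE gdim]]] := geodesic_segment s VW'.
  have [_ cg g0 g1 _] := pg'.
  have XE : X = W' by apply/eqP; rewrite eqEdim XW' dW' -g1 gdim leqnn.
  rewrite XE in Lg g1; rewrite Lmu -Lg; apply: ereal_inf_lbound.
  exists 0, 1, g; split; last exact: erefl.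
  by split; [exact: ler01|exact: cg|exact: g0|exact: g1|move=> t _; exact: gdim].
have pmu' : is_path s V W' a b mu by [].
have pot := potential_of_length pmu' Lmu'.
apply: (segment_of_potential pg (phi := fun t => dg V (mu t))); last first.
  rewrite mua mub dgxx (dg_proj_subspace VW PW').
  by rewrite subr0; exact: lexx.
move=> t u at_ tu ub; apply: le_trans (pot t u at_ tu ub).
have tb := le_trans tu ub; have au := le_trans at_ tu.
have [|pt gt] := sum t; first by rewrite in_itv /= at_.
have [|pu gu] := sum u; first by rewrite in_itv /= au.
have sub : (eta t <= eta u)%VS.
  by apply: (null_curve_sub neta tu); rewrite /= in_itv /= ?at_ ?au.
have put : perp (mu u) (eta t).
  apply/perpP => v w vu wt; move/perpP: pu; apply=> //.
  exact: (subvP sub).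
have dd : \dim (mu t) = \dim (mu u) by rewrite !dmu.
rewrite gt gu -(dg_add_common dd pt put); apply: dg_sub.
exact: addvS (subvv _) sub.
Qed.

End TypeI.

(** * Paths of type II *)

Section TypeII.
Variables (R : realType) (k : scalars) (n : nat).
Implicit Types (U V W : Gr R k n) (gamma : R -> Gr R k n) (a b t u : R).

Lemma near_left_ex (t0 x : R) (P : R -> Prop) : x < t0 ->
  (\forall t \near t0^'-, P t) -> exists t, [/\ x < t, t < t0 & P t].
Proof.
move=> xt h; near t0^'- => t; exists t; split; near: t => //.
  exact: nbhs_left_gt.
exact: nbhs_left_lt.
Unshelve. all: by end_near.
Qed.

Lemma near_right_ex (t0 x : R) (P : R -> Prop) : t0 < x ->
  (\forall t \near t0^'+, P t) -> exists t, [/\ t0 < t, t < x & P t].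
Proof.
move=> xt h; near t0^'+ => t; exists t; split; near: t => //.
  exact: nbhs_right_gt.
exact: nbhs_right_lt.
Unshelve. all: by end_near.
Qed.

Lemma dg_eq0_small V W :
  (forall e, 0 < e -> dg V W < e) -> (V <= W)%VS.
Proof.
move=> h; apply/dg_eq0P/eqP; rewrite eq_le dg_ge0 andbT leNgt; apply/negP => p.
by have := h _ p; rewrite ltxx.
Qed.

(** At most one step of a subdivision crosses the drop, and only this step has a
    nonzero distance, which is at most [Delta R p]. *)
Lemma length_one_drop a b gamma (before : R -> bool) p :
  (forall t u, t <= u -> before u -> before t) ->
  (forall t u, a <= t -> t <= u -> u <= b -> before u -> (gamma t <= gamma u)%VS) ->
  (forall t u, a <= t -> t <= u -> u <= b -> ~~ before t -> (gamma t <= gamma u)%VS) ->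
  (forall t, a <= t -> t <= b -> before t -> \dim (gamma t) = p) ->
  (exists t u, [/\ a <= t, t <= u & u <= b] /\ (before t /\ (\dim (gamma u) < p)%N)) ->
  curve_length `[a, b] gamma = (Delta R p)%:E.
Proof.
move=> mono bef aft dimb [t [u [[at_ tu ub] [bt du]]]].
have D0 : 0 <= Delta R p by rewrite mulr_ge0 ?sqrtr_ge0 // ltW // pihalf_gt0.
apply/eqP; rewrite eq_le; apply/andP; split; last first.
  have dt := dimb t at_ (le_trans tu ub) bt.
  rewrite -dt -(@dg_gtdim R k n (gamma t) (gamma u)) ?dt //.
  apply: dg_le_length => //=; rewrite in_itv /=.
    by rewrite at_ (le_trans tu ub).
  by rewrite (le_trans at_ tu) ub.
apply: (curve_length_le (phi := fun x => if before x then 0 else Delta R p)).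
- move=> x y /=; rewrite !in_itv /= => /andP[ax xb] /andP[ay yb] xy.
  have [by_|ny] := boolP (before y).
    rewrite (mono x y xy by_) (proj2 (dg_eq0P _ _) (bef x y ax xy yb by_)).
    by rewrite subrr.
  have [bx|nx] := boolP (before x); last first.
    by rewrite (proj2 (dg_eq0P _ _) (aft x y ax xy yb nx)) subrr.
  by rewrite subr0 -(dimb x ax xb bx); exact: dg_le_Delta.
- move=> x y _ _ xy; case: ifP => [by_|_].
    by rewrite (mono x y xy by_) subrr.
  by case: ifP => _; rewrite ?subr0 ?subrr.
- exact: D0.
Qed.

(** For the side [Plus], continuity forces the values near a point to have at
    least its dimension, so the contraction is from the left limit to the value
    at [t0], and this value is contained in the later ones.  For the side [Minus]
    the dimension is at most that of the point, so the contraction is to the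
    right limit, and the value at [t0] contains the earlier ones.  Either way
    there is exactly one drop, from a subspace of dimension [\dim V]. *)
Lemma type_II_length s V W a b gamma : type_II s V W a b gamma ->
  curve_length `[a, b] gamma = (Delta R (\dim V))%:E.
Proof.
move=> [[ab cg ga gb _] [t0 [U [U' [t0I dU [[U'nU U'U] con] N1 N2]]]]].
move: t0I; rewrite in_itv /= => /andP[at0 t0b].
have {}dU := Delta_inj dU.
have dU' : (\dim U' < \dim U)%N.
  rewrite ltn_neqAle dimvS // andbT; apply: contra U'nU => E.
  by rewrite eqEdim U'U (eqP E) leqnn.
have U1 : Delta R 1 <= Delta R (\dim U).
  by rewrite Delta_le (leq_ltn_trans _ dU').
have n1 t u : a <= t -> t <= u -> u < t0 -> (gamma t <= gamma u)%VS.
  move=> at_ tu ut; apply: (null_curve_sub N1 tu); rewrite /= in_itv /=.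
    by rewrite at_ (le_lt_trans tu).
  by rewrite (le_trans at_ tu) ut.
have n2 t u : t0 < t -> t <= u -> u <= b -> (gamma t <= gamma u)%VS.
  move=> at_ tu ut; apply: (null_curve_sub N2 tu); rewrite /= in_itv /=.
    by rewrite at_ (le_trans tu).
  by rewrite (lt_le_trans at_ tu) ut.
have abt0 : [set` `[a, b]] t0 by rewrite /= in_itv /= at0.
move/curveP: cg => /(_ t0 abt0) cg.
(* Within distance [Delta R 1] the dimension cannot decrease. *)
have Delta1 : 0 < Delta R 1 by exact: Delta_gt0.
case: con => [[lt [[ncv _] E]]|[lt [E [ncv _]]]].
- have dl x : a <= x -> x < t0 -> exists t, [/\ x < t, t < t0 & \dim (gamma t) = \dim U].
    by move=> ax xt; exact: near_left_ex ncv.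
  case: s cg => cg.
    exfalso; have [del del0 hd] := cg _ Delta1.
    have a1 : a <= Num.max a (t0 - del) by rewrite le_max lexx.
    have a2 : Num.max a (t0 - del) < t0 by rewrite gt_max lt ltrBlDr ltrDl.
    have [t [t1 t2 dt]] := dl _ a1 a2.
    have at1 : a < t by move: t1; rewrite gt_max => /andP[].
    have {}t1 : t0 - del < t by move: t1; rewrite gt_max => /andP[].
    have := hd t; rewrite /= in_itv /= (ltW at1) (le_trans (ltW t2) t0b) => /(_ isT).
    rewrite ltr_norml => /(_ _) h; have {}h := h ltac:(lra).
    by move: h; rewrite dg_gtdim ?dt -?E // ltNge U1.
  apply: (@length_one_drop _ _ _ (fun t => t < t0)).
  + by move=> t u; exact: le_lt_trans.
  + by move=> t u at_ tu ub ut; exact: n1.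
  + move=> t u at_ tu ub; rewrite -leNgt le_eqVlt => /orP[/eqP tE|t0t]; last exact: n2.
    move: tu; rewrite -tE le_eqVlt => /orP[/eqP <-|tu]; first exact: subvv.
    apply: dg_eq0_small => e /cg[del del0 hd].
    pose t' := Num.min u (t0 + del / 2).
    have t't : t0 < t' by rewrite lt_min tu ltrDl divr_gt0.
    have t'u : t' <= u by rewrite ge_min lexx.
    have t'd : t' <= t0 + del / 2 by rewrite ge_min lexx orbT.
    apply: le_lt_trans (hd t' _ _).
    * by apply: dg_sub; exact: n2.
    * by rewrite /= in_itv /= (le_trans at0 (ltW t't)) (le_trans t'u).
    * by rewrite ltr_norml; lra.
  + move=> t at_ tb tt; have [t' [tt' t't0 dt']] := dl t at_ tt.
    apply/eqP; rewrite eqn_leq; apply/andP; split.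
      by rewrite -dU -dt' dimvS // n1 // ltW.
    by rewrite -ga dimvS // n1.
  + by exists a, t0; split; [split|split; rewrite // -E -dU].
- have dr x : t0 < x -> exists t, [/\ t0 < t, t < x & \dim (gamma t) = \dim U'].
    by move=> xt; exact: near_right_ex ncv.
  case: s cg => cg; last first.
    exfalso; have [del del0 hd] := cg _ Delta1.
    have [|t [t1 t2 dt]] := dr (Num.min b (t0 + del)).
      by rewrite lt_min lt ltrDl.
    move: t2; rewrite lt_min => /andP[tb t2].
    have := hd t; rewrite /= in_itv /= (ltW tb) (le_trans at0 (ltW t1)) => /(_ isT).
    rewrite ltr_norml => /(_ _) h; have {}h := h ltac:(lra).
    by move: h; rewrite dg_gtdim ?dt -E // ltNge U1.
  have n0 t u : a <= t -> t <= u -> u <= t0 -> (gamma t <= gamma u)%VS.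
    move=> at_ tu; rewrite le_eqVlt => /orP[/eqP uE|ut]; last exact: n1.
    move: tu; rewrite uE le_eqVlt => /orP[/eqP <-|tu]; first exact: subvv.
    apply: dg_eq0_small => e /cg[del del0 hd].
    pose t' := Num.max t (t0 - del / 2).
    have t't : t' < t0 by rewrite gt_max tu ltrBlDr ltrDl divr_gt0.
    have t'u : t <= t' by rewrite le_max lexx.
    have t'd : t0 - del / 2 <= t' by rewrite le_max lexx orbT.
    apply: le_lt_trans (hd t' _ _).
    * apply: le_trans (dg_triangle _ (gamma t') _) _.
      rewrite (proj2 (dg_eq0P (gamma t) (gamma t')) (n1 _ _ at_ t'u t't)).
      by rewrite add0r; exact: lexx.
    * by rewrite /= in_itv /= (le_trans at_ t'u) (le_trans (ltW t't)).
    * by rewrite ltr_norml; lra.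
  apply: (@length_one_drop _ _ _ (fun t => t <= t0)).
  + by move=> t u; exact: le_trans.
  + by move=> t u at_ tu ub ut; exact: n0.
  + by move=> t u at_ tu ub; rewrite -ltNge => t0t; exact: n2.
  + move=> t at_ tb tt; apply/eqP; rewrite eqn_leq; apply/andP; split.
      by rewrite -dU E dimvS // n0.
    by rewrite -ga dimvS // n0.
  + have [t [t1 t2 dt]] := dr b lt.
    exists t0, t; split; first by split; [exact: at0|exact: ltW t1|exact: ltW t2].
    by split; [exact: lexx|rewrite dt -dU].
Qed.

Lemma type_II_segment s V W a b gamma : type_II s V W a b gamma ->
  (segment s V W a b gamma <-> perp V W \/ (\dim W < \dim V)%N).
Proof.
move=> H; have L := type_II_length H; have [pg _] := H.
split=> [[_]|/dg_eq_DeltaP E]; last by split=> //; rewrite L E.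
by rewrite L => -[E]; apply/dg_eq_DeltaP.
Qed.

End TypeII.

(** * Betweenness and the main theorem *)

Section Between.
Variables (R : realType) (k : scalars) (n : nat) (s : side).

(** Concatenation in one direction; in the other, a segment through [U] is a
    polygon through [U], and the triangle inequality gives the equality. *)
Lemma between_segment (U V W : Gr R k n) : dbetween V W U <->
  exists (a b : R) (gamma : R -> Gr R k n),
    segment s V W a b gamma /\ exists2 t, t \in `[a, b] & U = gamma t.
Proof.
split=> [E|[a [b [gamma [S [t]]]]]].
  have [a [b [g1 S1]]] := segment_exists s V U.
  have [c [d [g2 S2]]] := segment_exists s U W.
  by have [e [g H]] := segment_concat S1 S2 E; exists a, e, g.
rewrite in_itv /= => /andP[at_ tb] ->.
have [pg L] := S; have [_ _ _ gb _] := pg.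
have := potential_of_length pg; rewrite L lexx => /(_ isT t b at_ tb (lexx _)).
rewrite gb /dbetween /=; have := dg_triangle V (gamma t) W.
move=> H1 H2; apply/eqP; rewrite eq_le H1 /= -lerBrDl; exact: H2.
Qed.

End Between.

Theorem proposition4p31 (R : realType) (k : scalars) (n : nat) (s : side) :
  (* (i) *)
  ((forall (V W : Gr R k n) (a b : R) (gamma : R -> Gr R k n),
      minimal_geodesic s V W a b gamma -> segment s V W a b gamma) /\
   (forall (V W : Gr R k n) (a b : R) (gamma : R -> Gr R k n),
      type_I s V W a b gamma -> segment s V W a b gamma) /\
   (forall (V W : Gr R k n) (a b : R) (gamma : R -> Gr R k n),
      type_II s V W a b gamma ->
      (segment s V W a b gamma <-> perp V W \/ (\dim W < \dim V)%N))) /\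
  (* (ii) *)
  (forall V W : Gr R k n, exists (a b : R) (gamma : R -> Gr R k n),
      segment s V W a b gamma) /\
  (* (iii) *)
  (forall U V W : Gr R k n,
      dbetween V W U <->
      exists (a b : R) (gamma : R -> Gr R k n),
        segment s V W a b gamma /\
        exists2 t, t \in `[a, b] & U = gamma t).
Proof.
split; [split; [|split]|split].
- exact: minimal_geodesic_segment.
- exact: type_I_segment.
- exact: type_II_segment.
- exact: segment_exists.
- exact: between_segment.
Qed.
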